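(* Let $H\in(\tfrac12,1)$ and let $B^H$ be a one-dimensional fractional Brownian motion with Hurst parameter $H$. Let $p\ge1$, $\kappa\ge 2H$, $\lambda>0$ and $\mu>0$ be constants satisfying either (i) $\kappa>2H$ and $\lambda>0$, or (ii) $\kappa=2H$ and $-\lambda+\frac p2\mu^2<0$. Let $f:[0,\infty)\times\mathbb{R}\to\mathbb{R}$ satisfy $x f(t,x)\le-\lambda\kappa t^{\kappa-1}x^2$ for all $t>0$ and $x\in\mathbb{R}$, and let $c:[0,\infty)\to\mathbb{R}$ be a (deterministic) function with $|c(t)|\le\mu$ for all $t$. Let $X(t)$, $t\ge 0$, be the solution of $$dX(t)=f(t,X(t))\,dt+c(t)X(t)\,dB^H(t),\qquad X(0)=X_0,$$ where $X_0\in\mathbb{R}\setminus\{0\}$ is a constant. Then $\mathbb{E}|X(t)|^p\to0$ as $t\to\infty$.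
   Context: A fractional Brownian motion with Hurst parameter $H$ is a centered Gaussian process $(B^H(t))_{t\ge0}$ with covariance $\mathbb{E}[B^H(t)B^H(s)]=\frac12\left(t^{2H}+s^{2H}-|t-s|^{2H}\right)$. The integrals with respect to $B^H$ ($H>1/2$) are understood in the pathwise (Young / Riemann–Stieltjes) sense, for which the ordinary chain rule of calculus holds; it is implicit that $f$ and $c$ are regular enough for the equation to be well posed in this sense. *)

(* Defs.v *)
From HB Require Import structures.
From mathcomp Require Import all_boot all_order all_algebra.
From mathcomp Require Import all_classical all_reals all_analysis.
Set Implicit Arguments.
Unset Strict Implicit.
Unset Printing Implicit Defensive.
Import Order.TTheory GRing.Theory Num.Theory.
Import numFieldNormedType.Exports.
Local Open Scope classical_set_scope.
Local Open Scope ring_scope.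

Section gaussian_processes.
Context {d : measure_display} {T : measurableType d} {R : realType}.
Variable P : probability T R.

(* Degenerate laws count as Gaussian. They are treated apart because the
   library's [normal_prob m 0] is the uniform law on [0, 1], not [\d_m]. *)
Definition gaussian (Y : T -> R) : Prop :=
  exists m s : R, forall A : set R, measurable A ->
    P (Y @^-1` A) = if s == 0 then \d_m A else normal_prob m s A.

(* Processes indexed by [0, +oo[ are families over R whose values at negative
   times are never constrained or used. *)
Definition gaussian_process (B : R -> {RV P >-> R}) : Prop :=
  forall (n : nat) (t a : 'I_n -> R), (forall i, 0 <= t i) ->
    gaussian (fun w => \sum_(i < n) a i * B (t i) w).

(* Pathwise integration needs the version with continuous sample paths. *)
Definition fractional_brownian_motion (H : R) (B : R -> {RV P >-> R}) : Prop :=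
  [/\ gaussian_process B,
      (forall t : R, 0 <= t -> 'E_P[B t]%E = 0%E),
      (forall t s : R, 0 <= t -> 0 <= s ->
        'E_P[(fun w => B t w * B s w)%R]%E =
          (2^-1 * (t `^ (2 * H) + s `^ (2 * H) - `|t - s| `^ (2 * H)))%:E)
    & {ae P, forall w, {within `[0, +oo[, continuous (fun t => B t w)}}].

End gaussian_processes.

Section riemann_stieltjes.
Context {R : realType}.

(* [a :: s] lists the points of a partition of [a, b], and [xi i] is the tag of
   its i-th interval. *)
Definition tags (a : R) (s : seq R) (xi : nat -> R) : Prop :=
  forall i, (i < size s)%N -> nth a (a :: s) i <= xi i <= nth a (a :: s) i.+1.

Definition mesh_lt (a : R) (s : seq R) (delta : R) : Prop :=
  forall i, (i < size s)%N ->
    nth a (a :: s) i.+1 - nth a (a :: s) i < delta.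

Definition RS_sum (g h : R -> R) (a : R) (s : seq R) (xi : nat -> R) : R :=
  \sum_(0 <= i < size s)
    g (xi i) * (h (nth a (a :: s) i.+1) - h (nth a (a :: s) i)).

(* The integral of [g] against [h] over [a, b] exists and is equal to [l], as
   a limit of tagged sums when the mesh tends to 0. When [g] and [h] are Hoelder
   with exponents of sum > 1, it exists and is the Young integral. *)
Definition is_RS_integral (g h : R -> R) (a b l : R) : Prop :=
  forall e, 0 < e -> exists2 delta, 0 < delta &
    forall (s : seq R) (xi : nat -> R),
      itv_partition a b s -> tags a s xi -> mesh_lt a s delta ->
      `|RS_sum g h a s xi - l| < e.

Definition RS_integrable (g h : R -> R) (a b : R) : Prop :=
  exists l, is_RS_integral g h a b l.

End riemann_stieltjes.

Section pathwise_equation.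
Context {d : measure_display} {T : measurableType d} {R : realType}.
Variable P : probability T R.

(* Pathwise solution of dX = f(t, X) dt + c(t) X dB, X(0) = X0. Existence of
   both integrals is part of being a solution; the case t = 0 of the equation
   gives X(0) = X0. *)
Definition pathwise_solution (f : R -> R -> R) (c : R -> R)
    (B : R -> {RV P >-> R}) (X0 : R) (X : R -> {RV P >-> R}) : Prop :=
  {ae P, forall w, forall t : R, 0 <= t ->
    lebesgue_measure.-integrable `[0, t] (fun s => (f s (X s w))%:E) /\
    exists2 I,
      is_RS_integral (fun s => c s * X s w) (fun s => B s w) 0 t I &
      X t w = X0 + \int[lebesgue_measure]_(s in `[0, t]) f s (X s w) + I}.

(* Regularity of a deterministic coefficient c that makes dX = c(t) X dB
   meaningful, X being X0 exp(int c dB). It holds in particular for c locally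
   Hoelder of exponent > 1 - H and B a fractional Brownian motion. *)
Definition pathwise_integrable (c : R -> R) (B : R -> {RV P >-> R}) : Prop :=
  {ae P, forall w, forall t : R, 0 <= t ->
    RS_integrable c (fun s => B s w) 0 t}.

End pathwise_equation.

(* Main.v *)
(** The path of B is only known to be continuous, but existence of the
    Riemann-Stieltjes integrals is a strong hypothesis: by the Saks-Henstock
    lemma the integral Y of c and the integral of c X satisfy
    sum |dY - c dB| -> 0 and sum |d(int c X dB) - c X dB| -> 0 along uniform
    partitions, for either choice of the end point as tag. Comparing the two
    choices gives sum |c dX dB| -> 0, hence (dX)^2, dX dY and X (dY)^2 have
    vanishing sums and the first order chain rule holds along the solution.
    Applied to X^2 exp(2 lambda t^kappa - 2 Y), which the condition on f makes
    nonincreasing, it gives |X(t)| <= |X0| exp(- lambda t^kappa + Y(t)).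

    The Riemann sums of Y are centered Gaussian variables. Increments of B are
    nonnegatively correlated because 2 H >= 1, so the variance of these sums is at
    most mu^2 t^(2H), and by Fatou
    E |X(t)|^p <= |X0|^p exp(- p lambda t^kappa + p^2 mu^2 t^(2H) / 2). *)
Require Import Defs.
From HB Require Import structures.
From mathcomp Require Import all_boot all_order all_algebra.
From mathcomp Require Import all_classical all_reals all_analysis.
From mathcomp Require Import measurable_realfun ring lra.
Import Order.TTheory GRing.Theory Num.Theory.
Import numFieldNormedType.Exports.
Local Open Scope classical_set_scope.
Local Open Scope ring_scope.
Set Implicit Arguments.
Unset Strict Implicit.
Unset Printing Implicit Defensive.

(** * Riemann-Stieltjes sums *)

(** Only the value of a tagged sum is kept: points and tags stay hidden, and adjacent partitions are
    handled by adding values. *)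
Definition RS_value {R : realType} (g h : R -> R) (a b delta v : R) : Prop :=
  exists (s : seq R) (xi : nat -> R),
    [/\ itv_partition a b s, tags a s xi, mesh_lt a s delta
      & RS_sum g h a s xi = v].

Section riemann_stieltjes_values.
Context {R : realType} (g h : R -> R).
Implicit Types (a b c delta u v T : R).

Lemma is_RS_integralP a b l : is_RS_integral g h a b l <->
  forall e, 0 < e -> exists2 delta, 0 < delta &
    forall v, RS_value g h a b delta v -> `|v - l| < e.
Proof.
split=> H e e0; have [delta d0 Hd] := H e e0; exists delta => //.
  by move=> _ [s [xi [abs tg ms <-]]]; exact: Hd.
by move=> s xi abs tg ms; apply: Hd; exists s, xi.
Qed.

Lemma RS_value_le a b delta delta' v : delta <= delta' ->
  RS_value g h a b delta v -> RS_value g h a b delta' v.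
Proof.
move=> dd [s [xi [abs tg ms vE]]]; exists s, xi; split=> // i si.
exact: lt_le_trans (ms i si) dd.
Qed.

Lemma RS_value0 a delta : RS_value g h a a delta 0.
Proof.
by exists [::], (fun=> a); split=> //; rewrite /RS_sum big_geq.
Qed.

Lemma RS_value1 a b delta c : a < b -> a <= c <= b -> b - a < delta ->
  RS_value g h a b delta (g c * (h b - h a)).
Proof.
move=> ab acb bad; exists [:: b], (fun=> c); split.
- exact: itv_partition1.
- by case.
- by case.
- by rewrite /RS_sum /= big_nat1.
Qed.

Lemma RS_value_cat a b c delta u v :
  RS_value g h a b delta u -> RS_value g h b c delta v ->
  RS_value g h a c delta (u + v).
Proof.
move=> [s [xi [abs tgs ms <-]]] [t [xi' [bct tgt mt <-]]].
have lb : last a s = b by case: abs => _ /eqP.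
have nl i : (i <= size s)%N -> nth a (a :: s ++ t) i = nth a (a :: s) i.
  by move=> si; rewrite -cat_cons nth_cat /= ltnS si.
(* At [i = 0] this says that the last point of the first partition is the base point [b] of the
   second, hence the separate case. *)
have nr i : (i <= size t)%N ->
    nth a (a :: s ++ t) (size s + i) = nth b (b :: t) i.
  case: i => [_|i it].
    by rewrite addn0 nl// -[size s]/((size (a :: s)).-1) nth_last.
  rewrite addnS /= nth_cat ltnNge leq_addr /= addKn; exact: set_nth_default.
exists (s ++ t), (fun k => if (k < size s)%N then xi k else xi' (k - size s)%N).
split.
- exact: itv_partition_cat bct.
- move=> i; rewrite size_cat; have [si _|si] := ltnP i (size s).
    by rewrite !nl// 1?ltnW//; exact: tgs.
  rewrite -(subnKC si) ltn_add2l => it; rewrite addKn -addnS !nr// 1?ltnW//.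
  exact: tgt.
- move=> i; rewrite size_cat; have [si _|si] := ltnP i (size s).
    by rewrite !nl// 1?ltnW//; exact: ms.
  rewrite -(subnKC si) ltn_add2l => it; rewrite -addnS !nr// 1?ltnW//.
  exact: mt.
- rewrite /RS_sum size_cat (@big_cat_nat _ _ _ (size s)) ?leq_addr//=; congr (_ + _).
    apply: eq_big_nat => i /andP[_ si]; rewrite si.
    by rewrite -[nth a (s ++ t) i]/(nth a (a :: s ++ t) i.+1) !nl// ltnW.
  rewrite -{1}[size s]add0n big_addn addKn.
  apply: eq_big_nat => i /andP[_ it].
  rewrite ltnNge leq_addl /= addnK.
  rewrite -[nth a (s ++ t) (i + _)]/(nth a (a :: s ++ t) (i + size s).+1).
  by rewrite addnC -addnS !nr// ltnW.
Qed.

Lemma RS_value_sum (t : nat -> R) (v : nat -> R) delta n :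
  (forall i, (i < n)%N -> RS_value g h (t i) (t i.+1) delta (v i)) ->
  RS_value g h (t 0%N) (t n) delta (\sum_(i < n) v i).
Proof.
elim: n => [_|n IH H]; first by rewrite big_ord0; exact: RS_value0.
rewrite big_ord_recr /=; apply: RS_value_cat; last exact: H.
by apply: IH => i ni; apply: H; rewrite ltnW.
Qed.

Lemma RS_value_exists a b delta : a <= b -> 0 < delta ->
  exists v, RS_value g h a b delta v.
Proof.
rewrite le_eqVlt => /predU1P[->|ab] d0; first by exists 0; exact: RS_value0.
have [n Hn] : exists n : nat, (b - a) / delta < n%:R.
  exists (Num.truncn ((b - a) / delta)).+1; exact: truncnS_gt.
have n0 : 0 < n%:R :> R by apply: le_lt_trans Hn; rewrite divr_ge0 ?subr_ge0 ?ltW.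
pose t (i : nat) := a + i%:R * ((b - a) / n%:R).
have s0 : 0 < (b - a) / n%:R by rewrite divr_gt0 ?subr_gt0.
have dt i : t i.+1 - t i = (b - a) / n%:R.
  by rewrite /t -natr1 mulrDl mul1r opprD addrACA subrr add0r addrAC subrr add0r.
exists (\sum_(i < n) g (t i) * (h (t i.+1) - h (t i))).
have -> : b = t n by rewrite /t mulrC divfK ?gt_eqF// subrKC.
have {1}-> : a = t 0%N by rewrite /t mul0r addr0.
apply: (@RS_value_sum t (fun i => g (t i) * (h (t i.+1) - h (t i)))) => i _.
have tt : t i < t i.+1 by rewrite -subr_gt0 dt.
apply: RS_value1 => //; first by rewrite lexx ltW.
by rewrite dt ltr_pdivrMr// mulrC -ltr_pdivrMr.
Qed.

(** A fine partition of [[0, a]] followed by a fine one of [[a, b]] has a sum close to [v], while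
    its first part has a sum close to [u]. The second part is therefore close to [v - u]. *)
Lemma RS_value_approx a b u v delta e : 0 <= a -> a <= b ->
  is_RS_integral g h 0 a u -> is_RS_integral g h 0 b v ->
  0 < delta -> 0 < e ->
  exists2 w, RS_value g h a b delta w & `|w - (v - u)| < e.
Proof.
move=> a0 ab /is_RS_integralP Hu /is_RS_integralP Hv d0 e0.
have [d1 d10 H1] := Hu _ (divr_gt0 e0 (ltr0n _ 2)).
have [d2 d20 H2] := Hv _ (divr_gt0 e0 (ltr0n _ 2)).
pose d := Num.min delta (Num.min d1 d2).
have dp : 0 < d by rewrite !lt_min d0 d10.
have [x Hx] := RS_value_exists a0 dp.
have [w Hw] := RS_value_exists ab dp.
exists w; first by apply: RS_value_le Hw; rewrite ge_min lexx.
have h1 : `|x - u| < e / 2.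
  by apply: H1; apply: RS_value_le Hx; rewrite /d !ge_min lexx !orbT.
have h2 : `|x + w - v| < e / 2.
  apply: H2; apply: RS_value_le (RS_value_cat Hx Hw).
  by rewrite /d !ge_min lexx !orbT.
have -> : w - (v - u) = (x + w - v) - (x - u) by ring.
by rewrite (le_lt_trans (ler_normB _ _))// [e]splitr ltrD.
Qed.

Lemma is_RS_integralxx a l : is_RS_integral g h a a l -> l = 0.
Proof.
move=> /is_RS_integralP H; apply/eqP; rewrite -normr_eq0; apply/eqP.
apply/le_anti; rewrite normr_ge0 andbT; apply/ler_addgt0Pr => e e0.
have [d d0 Hd] := H e e0.
by have := Hd 0 (RS_value0 _ _); rewrite sub0r normrN add0r => /ltW.
Qed.

End riemann_stieltjes_values.

(** * Uniform partitions of [[0, T]] *)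

Definition grid {R : realType} (T : R) (n i : nat) : R := i%:R * (T / n%:R).

(** The interval functions that first order calculus treats as zero. Absolute values inside the sum
    make the class stable under bounded factors. *)
Definition negligible_sums {R : realType} (T : R) (phi : R -> R -> R) : Prop :=
  \sum_(i < n) `|phi (grid T n i) (grid T n i.+1)| @[n --> \oo] --> (0 : R).

Section grid.
Context {R : realType} (T : R).
Hypothesis T0 : 0 < T.

Lemma grid0 n : grid T n 0 = 0. Proof. by rewrite /grid mul0r. Qed.

Lemma gridn n : (0 < n)%N -> grid T n n = T.
Proof. by move=> n0; rewrite /grid mulrC divfK// pnatr_eq0 -lt0n. Qed.

Lemma grid_step n i : grid T n i.+1 - grid T n i = T / n%:R.
Proof. by rewrite /grid -mulrBl -natr1 addrAC subrr add0r mul1r. Qed.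

Lemma grid_le n i j : (i <= j)%N -> grid T n i <= grid T n j.
Proof.
by move=> ij; rewrite /grid ler_wpM2r ?ler_nat// divr_ge0 ?ler0n// ltW.
Qed.

Lemma grid_lt n i : (i < n)%N -> grid T n i < grid T n i.+1.
Proof.
move=> ni; rewrite -subr_gt0 grid_step divr_gt0// ltr0n.
exact: leq_ltn_trans ni.
Qed.

Lemma grid_ge0 n i : 0 <= grid T n i.
Proof. by rewrite -(grid0 n) grid_le. Qed.

Lemma grid_leT n i : (i <= n)%N -> grid T n i <= T.
Proof.
case: n => [|n] ni; last by rewrite -[leRHS](@gridn n.+1)// grid_le.
by move: ni; rewrite leqn0 => /eqP ->; rewrite grid0 ltW.
Qed.

Lemma grid_step_lt delta : 0 < delta -> \forall n \near \oo, T / n%:R < delta.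
Proof.
move=> d0; exists (Num.truncn (T / delta)).+1 => // n /= Hn.
have n0 : 0 < n%:R :> R by rewrite ltr0n; exact: leq_ltn_trans Hn.
rewrite ltr_pdivrMr// mulrC -ltr_pdivrMr//.
by apply: lt_le_trans (truncnS_gt _) _; rewrite ler_nat.
Qed.

End grid.

(** * The Saks-Henstock lemma for Riemann-Stieltjes integrals *)

(** The closure of the set of sums of mesh below [delta]. It contains the increments of the integral
    besides the sums themselves, so that both kinds of terms can be mixed on one partition. *)
Definition RS_adherent {R : realType} (g h : R -> R) (a b delta w : R) : Prop :=
  forall e, 0 < e -> exists2 v, RS_value g h a b delta v & `|v - w| < e.

Section saks_henstock.
Context {R : realType} (g h Y : R -> R) (T : R).
Hypothesis T0 : 0 < T.
Hypothesis hY : forall t, 0 <= t -> t <= T -> is_RS_integral g h 0 t (Y t).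

Lemma RS_adherent_value a b delta v :
  RS_value g h a b delta v -> RS_adherent g h a b delta v.
Proof. by move=> vP e e0; exists v; rewrite ?subrr ?normr0. Qed.

Lemma RS_adherent_integral a b delta : 0 < delta -> 0 <= a -> a <= b -> b <= T ->
  RS_adherent g h a b delta (Y b - Y a).
Proof.
move=> d0 a0 ab bT e e0; apply: RS_value_approx => //; apply: hY => //.
  exact: le_trans bT.
exact: le_trans ab.
Qed.

Lemma RS_adherent_cat a b c delta u v :
  RS_adherent g h a b delta u -> RS_adherent g h b c delta v ->
  RS_adherent g h a c delta (u + v).
Proof.
move=> Hu Hv e e0.
have [u' u'P u'u] := Hu _ (divr_gt0 e0 (ltr0n _ 2)).
have [v' v'P v'v] := Hv _ (divr_gt0 e0 (ltr0n _ 2)).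
exists (u' + v'); first exact: RS_value_cat v'P.
by rewrite opprD addrACA (le_lt_trans (ler_normD _ _))// [e]splitr ltrD.
Qed.

Lemma RS_adherent_sum (t v : nat -> R) delta n :
  (forall i, (i < n)%N -> RS_adherent g h (t i) (t i.+1) delta (v i)) ->
  RS_adherent g h (t 0%N) (t n) delta (\sum_(i < n) v i).
Proof.
elim: n => [_|n IH H].
  by rewrite big_ord0; apply: RS_adherent_value; exact: RS_value0.
rewrite big_ord_recr /=; apply: RS_adherent_cat; last exact: H.
by apply: IH => i ni; apply: H; rewrite ltnW.
Qed.

Lemma RS_adherent_close e : 0 < e -> exists2 delta, 0 < delta &
  forall w, RS_adherent g h 0 T delta w -> `|w - Y T| <= e.
Proof.
move=> e0; have /is_RS_integralP/(_ _ e0)[delta d0 Hd] := hY (ltW T0) (lexx T).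
exists delta => // w Hw; apply/ler_addgt0Pr => r r0.
have [v vP vw] := Hw _ r0.
have -> : w - Y T = (v - Y T) - (v - w) by ring.
by rewrite (le_trans (ler_normB _ _))// lerD// ltW// Hd.
Qed.

Lemma RS_integral_at0 : Y 0 = 0.
Proof. by apply: (@is_RS_integralxx _ g h 0); apply: hY => //; exact: ltW. Qed.

(** On [[0, s]] and [[t, T]] the exact increments of [Y] are taken, on [[s, t]] the single term with
    tag [x]. The distance to [Y T] is then the error on [[s, t]] alone, with a [delta] uniform in
    [s], [t] and [x]. *)
Lemma henstock_interval e : 0 < e -> exists2 delta, 0 < delta &
  forall s t x, 0 <= s -> t <= T -> s <= x -> x <= t -> t - s < delta ->
    `|Y t - Y s - g x * (h t - h s)| <= e.
Proof.
move=> e0; have [delta d0 Hd] := RS_adherent_close e0.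
exists delta => // s t x s0 tT sx xt ts.
have : s <= t by exact: le_trans xt.
rewrite le_eqVlt => /predU1P[<-|st]; first by rewrite !subrr mulr0 subrr normr0 ltW.
have := Hd (Y s - Y 0 + g x * (h t - h s) + (Y T - Y t)).
rewrite RS_integral_at0 subr0 distrC.
have -> : Y T - (Y s + g x * (h t - h s) + (Y T - Y t)) =
  Y t - Y s - g x * (h t - h s) by ring.
apply; apply: RS_adherent_cat; last first.
  by apply: RS_adherent_integral => //; rewrite (le_trans s0)// ltW.
apply: RS_adherent_cat; last first.
  by apply/RS_adherent_value/RS_value1 => //; rewrite sx.
have := @RS_adherent_integral 0 s delta d0 (lexx 0) s0.
by rewrite RS_integral_at0 subr0; apply; rewrite (le_trans _ tT)// ltW.
Qed.

(* Saks-Henstock: on a fixed partition the Riemann-Stieltjes term of each interval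
   may be replaced, independently of the others, by the increment of the
   integral, so that the errors of either sign are controlled separately. *)
Lemma saks_henstock (tag : R -> R -> R) :
  (forall s t, s <= t -> s <= tag s t <= t) ->
  negligible_sums T (fun s t => Y t - Y s - g (tag s t) * (h t - h s)).
Proof.
move=> htag; apply/cvgr0Pnorm_le => e e0.
have [delta d0 Hd] := RS_adherent_close (divr_gt0 e0 (ltr0n _ 2)).
near=> n.
have n0 : (0 < n)%N by near: n; exact: nbhs_infty_gt.
have nd : T / n%:R < delta by near: n; exact: grid_step_lt.
rewrite ger0_norm ?sumr_ge0//.
pose t i := grid T n i.
pose G i := g (tag (t i) (t i.+1)) * (h (t i.+1) - h (t i)).
pose D i := Y (t i.+1) - Y (t i).
have YT : Y T = \sum_(i < n) D i.
  rewrite -(big_mkord xpredT D) /D telescope_sumr// /t gridn// grid0.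
  by rewrite RS_integral_at0 subr0.
have key (Q : pred nat) : `|\sum_(i < n) (if Q i then D i - G i else 0)| <= e / 2.
  have -> : \sum_(i < n) (if Q i then D i - G i else 0) =
      Y T - \sum_(i < n) (if Q i then G i else D i).
    by rewrite YT -sumrB; apply: eq_bigr => i _; case: ifP; rewrite ?subrr.
  rewrite distrC; apply: Hd.
  rewrite -[X in RS_adherent _ _ X](grid0 T n) -[X in RS_adherent _ _ _ X](gridn T n0).
  apply: (@RS_adherent_sum t (fun i => if Q i then G i else D i)) => i ni.
  case: ifP => _.
    apply/RS_adherent_value/RS_value1; first exact: grid_lt.
      by apply: htag; exact: grid_le.
    by rewrite grid_step.
  apply: RS_adherent_integral => //; [exact: grid_ge0|exact: grid_le|exact: grid_leT].
have -> : \sum_(i < n) `|Y (grid T n i.+1) - Y (grid T n i) -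
    g (tag (grid T n i) (grid T n i.+1)) * (h (grid T n i.+1) - h (grid T n i))| =
  \sum_(i < n) (if 0 <= D i - G i then D i - G i else 0) -
  \sum_(i < n) (if D i - G i < 0 then D i - G i else 0).
  rewrite -sumrB; apply: eq_bigr => i _; rewrite -/(t i) -/(t i.+1) -/(D i) -/(G i).
  by case: leP => [/ger0_norm ->|/ltr0_norm ->]; rewrite ?subr0 ?sub0r.
rewrite [e]splitr lerD// (le_trans (ler_norm _))//.
  exact: (key (fun i => 0 <= D i - G i)).
rewrite normrN; exact: (key (fun i => D i - G i < 0)).
Unshelve. all: by end_near. Qed.

End saks_henstock.

(** * Negligible functions of an interval *)

Definition small_increments {R : realType} (T : R) (u : R -> R -> R) : Prop :=
  forall e, 0 < e -> exists2 delta, 0 < delta &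
    forall s t, 0 <= s -> s <= t -> t <= T -> t - s < delta -> `|u s t| <= e.

Section negligible_sums.
Context {R : realType} (T : R).
Hypothesis T0 : 0 < T.
Implicit Types (phi psi u : R -> R -> R) (B f : R -> R) (K : R).

Lemma negligible_sums_le K phi psi :
  (forall s t, 0 <= s -> s <= t -> t <= T -> `|phi s t| <= K * `|psi s t|) ->
  negligible_sums T psi -> negligible_sums T phi.
Proof.
move=> le_phi psi0; have Kpsi0 : K * \sum_(i < n) `|psi (grid T n i) (grid T n i.+1)|
    @[n --> \oo] --> (0 : R).
  by rewrite -[X in _ --> X](mulr0 K); apply: cvgM => //; exact: cvg_cst.
rewrite /negligible_sums; apply: (squeeze_cvgr _ _ Kpsi0); last exact: cvg_cst.
near=> n; rewrite sumr_ge0//= mulr_sumr.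
by apply: ler_sum => i _; apply: le_phi; [exact: grid_ge0|exact: grid_le|exact: grid_leT].
Unshelve. all: by end_near. Qed.

Lemma eq_negligible_sums phi psi :
  (forall s t, 0 <= s -> s <= t -> t <= T -> phi s t = psi s t) ->
  negligible_sums T psi -> negligible_sums T phi.
Proof.
by move=> e; apply: (@negligible_sums_le 1) => s t *; rewrite mul1r e.
Qed.

Lemma negligible_sumsD phi psi :
  negligible_sums T phi -> negligible_sums T psi ->
  negligible_sums T (fun s t => phi s t + psi s t).
Proof.
move=> phi0 psi0; have D0 : \sum_(i < n) `|phi (grid T n i) (grid T n i.+1)| +
    \sum_(i < n) `|psi (grid T n i) (grid T n i.+1)| @[n --> \oo] --> (0 : R).
  by rewrite -[X in _ --> X](addr0 0); exact: cvgD.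
rewrite /negligible_sums; apply: (squeeze_cvgr _ _ D0); last exact: cvg_cst.
near=> n; rewrite sumr_ge0//= -big_split /=.
by apply: ler_sum => i _; exact: ler_normD.
Unshelve. all: by end_near. Qed.

Lemma negligible_sumsN phi :
  negligible_sums T phi -> negligible_sums T (fun s t => - phi s t).
Proof. by apply: (@negligible_sums_le 1) => s t *; rewrite mul1r normrN. Qed.

Lemma negligible_sumsB phi psi :
  negligible_sums T phi -> negligible_sums T psi ->
  negligible_sums T (fun s t => phi s t - psi s t).
Proof. by move=> ? ?; apply: negligible_sumsD => //; exact: negligible_sumsN. Qed.

Lemma negligible_sumsMl K u phi :
  (forall s t, 0 <= s -> s <= t -> t <= T -> `|u s t| <= K) ->
  negligible_sums T phi -> negligible_sums T (fun s t => u s t * phi s t).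
Proof.
move=> uK; apply: (@negligible_sums_le K) => s t *.
by rewrite normrM ler_wpM2r// uK.
Qed.

Lemma negligible_sums_eventually phi psi delta : 0 < delta ->
  (forall s t, 0 <= s -> s <= t -> t <= T -> t - s < delta ->
    `|phi s t| <= `|psi s t|) ->
  negligible_sums T psi -> negligible_sums T phi.
Proof.
move=> d0 le_phi psi0.
rewrite /negligible_sums; apply: (squeeze_cvgr _ _ psi0); last exact: cvg_cst.
near=> n; rewrite sumr_ge0//=.
apply: ler_sum => i _; apply: le_phi; rewrite ?grid_step.
- exact: grid_ge0.
- exact: grid_le.
- exact: grid_leT.
- by near: n; exact: grid_step_lt.
Unshelve. all: by end_near. Qed.

Lemma negligible_sums_smallM u phi : small_increments T u ->
  negligible_sums T phi -> negligible_sums T (fun s t => u s t * phi s t).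
Proof.
move=> /(_ 1 ltr01)[delta d0 Hd]; apply: (negligible_sums_eventually d0) => s t *.
by rewrite normrM ler_piMl// Hd.
Qed.

(** The increments of [B] telescope along the grid, so a rate [e] against them bounds the sum by
    [e * (B T - B 0)]. *)
Lemma negligible_sums_rate B phi :
  (forall e, 0 < e -> exists2 delta, 0 < delta &
    forall s t, 0 <= s -> s <= t -> t <= T -> t - s < delta ->
      `|phi s t| <= e * (B t - B s)) ->
  negligible_sums T phi.
Proof.
move=> H; rewrite /negligible_sums; apply/cvgr0Pnorm_le => e e0.
(* The added 1 keeps the divisor positive when [B T = B 0]. *)
pose C := 1 + `|B T - B 0|.
have C0 : 0 < C by rewrite ltr_pwDl.
have [delta d0 Hd] := H _ (divr_gt0 e0 C0).
near=> n.
have n0 : (0 < n)%N by near: n; exact: nbhs_infty_gt.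
rewrite ger0_norm ?sumr_ge0//.
apply: (@le_trans _ _ (\sum_(i < n) e / C * (B (grid T n i.+1) - B (grid T n i)))).
  apply: ler_sum => i _; apply: Hd; rewrite ?grid_step.
  - exact: grid_ge0.
  - exact: grid_le.
  - exact: grid_leT.
  - by near: n; exact: grid_step_lt.
rewrite -mulr_sumr -(big_mkord xpredT (fun i => B (grid T n i.+1) - B (grid T n i))).
rewrite telescope_sumr// gridn// grid0 mulrAC ler_pdivrMr// ler_pM2l//.
by rewrite (le_trans (ler_norm _))// lerDr.
Unshelve. all: by end_near. Qed.

(** The vanishing covariation of a continuous function with one of bounded variation: [B] plays the
    role of the variation function. *)
Lemma negligible_sums_small_bv u B psi : small_increments T u ->
  (forall s t, 0 <= s -> s <= t -> t <= T -> `|psi s t| <= B t - B s) ->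
  negligible_sums T (fun s t => u s t * psi s t).
Proof.
move=> us psiB; apply: (@negligible_sums_rate B) => e /us[delta d0 Hd].
exists delta => // s t s0 st tT ts; rewrite normrM ler_pM//; first exact: Hd.
exact: psiB.
Qed.

(** Summing over the grid replaces the integration of a differential inequality: local errors that
    are negligible disappear in the limit. *)
Lemma negligible_increments_le f phi :
  (forall s t, 0 <= s -> s <= t -> t <= T -> f t - f s <= phi s t) ->
  negligible_sums T phi -> f T <= f 0.
Proof.
move=> le_f phi0; rewrite -subr_le0.
apply/ler_addgt0Pr => e e0; rewrite add0r.
have /cvgr0Pnorm_le/(_ e e0) small := phi0.
near \oo => n.
have n0 : (0 < n)%N by near: n; exact: nbhs_infty_gt.
apply: (@le_trans _ _ (\sum_(i < n) `|phi (grid T n i) (grid T n i.+1)|)); last first.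
  by rewrite (le_trans (ler_norm _))//; near: n.
have -> : f T - f 0 = \sum_(i < n) (f (grid T n i.+1) - f (grid T n i)).
  rewrite -(big_mkord xpredT (fun i => f (grid T n i.+1) - f (grid T n i))).
  by rewrite telescope_sumr// gridn// grid0.
apply: ler_sum => i _; apply: le_trans (ler_norm _).
by apply: le_f; [exact: grid_ge0|exact: grid_le|exact: grid_leT].
Unshelve. all: by end_near. Qed.

Lemma small_incrementsD u1 u2 : small_increments T u1 -> small_increments T u2 ->
  small_increments T (fun s t => u1 s t + u2 s t).
Proof.
move=> H1 H2 e e0.
have [d1 d10 {}H1] := H1 _ (divr_gt0 e0 (ltr0n _ 2)).
have [d2 d20 {}H2] := H2 _ (divr_gt0 e0 (ltr0n _ 2)).
exists (Num.min d1 d2); first by rewrite lt_min d10.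
move=> s t s0 st tT; rewrite lt_min => /andP[ts1 ts2].
by rewrite (le_trans (ler_normD _ _))// [e]splitr lerD// ?H1 ?H2.
Qed.

Lemma continuous_small_increments f : {within `[0, T], continuous f} ->
  small_increments T (fun s t => f t - f s).
Proof.
move=> cf e e0.
(* Uniform continuity on a compact interval: the near-covering form of compactness turns a [delta]
   valid near each point into a single one. *)
have /compact_near_coveringP/near_covering_withinP cover := @segment_compact R 0 T.
have : \forall delta \near 0^'+, `[0, T] `<=` (fun s => forall t, 0 <= t -> t <= T ->
    `|t - s| < delta -> `|f t - f s| <= e).
  apply: cover => r r0T.
  have /subspace_continuousP/(_ r r0T)/cvgrPdist_le /(_ _ (divr_gt0 e0 (ltr0n _ 2))) := cf.
  rewrite near_withinE => /nbhs_ballP[d /= d0 Hd].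
  (* Half of the radius is for [s] and half for the distance from [s] to [t], so that [t] stays
     within [d] of [r]. *)
  exists (ball r (d / 2), [set x | x < d / 2]) => /=.
    split; first by apply: nbhsx_ballx; rewrite divr_gt0.
    by apply: nbhs_right_lt; rewrite divr_gt0.
  move=> [s delta] /= [+ deltad]; rewrite -ball_normE/= in_itv/= => rs s0T t t0 tT ts.
  have -> : f t - f s = (f r - f s) - (f r - f t) by ring.
  rewrite (le_trans (ler_normB _ _))// [e]splitr lerD//; apply: Hd; rewrite -?ball_normE /=.
  - by rewrite (lt_trans rs)// ltr_pdivrMr// ltr_pMr// ltr1n.
  - by rewrite in_itv.
  - have -> : r - t = (r - s) - (t - s) by ring.
    rewrite (le_lt_trans (ler_normB _ _))// [d]splitr ltrD//.
    exact: lt_trans deltad.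
  - by rewrite in_itv/= t0.
move=> H; near (0 : R)^'+ => delta.
exists delta => // s t s0 st tT ts.
have /(_ s) : `[0, T] `<=` (fun s => forall t, 0 <= t -> t <= T ->
    `|t - s| < delta -> `|f t - f s| <= e) by near: delta.
apply => /=; rewrite ?in_itv/= ?s0 ?(le_trans st)// ?(le_trans s0)//.
by rewrite ger0_norm ?subr_ge0.
Unshelve. all: by end_near. Qed.

Lemma continuous_bounded f : {within `[0, T], continuous f} ->
  exists K, forall t, 0 <= t -> t <= T -> `|f t| <= K.
Proof.
move=> cf; have [m _ Hm] := EVT_min (ltW T0) cf; have [M _ HM] := EVT_max (ltW T0) cf.
exists (Num.max `|f m| `|f M|) => t t0 tT.
have tin : t \in `[0, T] by rewrite in_itv/= t0.
have := Hm t tin; have := HM t tin; rewrite le_max.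
have [ft0|ft0] := leP 0 (f t).
  move=> ftM _; apply/orP; right; rewrite (ger0_norm ft0).
  exact: le_trans (ler_norm _).
move=> _ mft; apply/orP; left.
by rewrite (ltr0_norm ft0) -normrN (le_trans _ (ler_norm _))// lerN2.
Qed.

End negligible_sums.

(** * The pathwise bound *)

(** The tangent bound at [z] gives [1 + z <= expR z], and at [- z] it gives [expR z <= 1 / (1 - z)].
    The gap between the two bounds is [z ^+ 2 / (1 - z)], at most [2 * z ^+ 2] here. *)
Lemma expR_second_order {R : realType} (z : R) :
  `|z| <= 2^-1 -> `|expR z - 1 - z| <= 2 * z ^+ 2.
Proof.
rewrite ler_norml => /andP[z1 z2].
have lo := expR_ge1Dx z; have := expR_ge1Dx (- z); rewrite expRN => up.
have e0 := expR_gt0 z.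
have {}up : expR z * (1 - z) <= 1.
  by rewrite -(ler_pdivlMl _ _ e0) mulr1.
rewrite ger0_norm; last by lra.
nra.
Qed.

(** With the tag placed at the fixed point [r], [henstock_interval] compares [Y r - Y t] with
    [g r * (h r - h t)], and [g] enters through the one value [g r]. *)
Lemma RS_integral_continuous {R : realType} (g h Y : R -> R) (T : R) : 0 < T ->
  (forall t, 0 <= t -> t <= T -> is_RS_integral g h 0 t (Y t)) ->
  {within `[0, T], continuous h} -> {within `[0, T], continuous Y}.
Proof.
move=> T0 hY /subspace_continuousP ch; apply/subspace_continuousP => r r0T.
apply/cvgrPdist_le => e e0.
have [delta d0 Hd] := henstock_interval T0 hY (divr_gt0 e0 (ltr0n _ 2)).
have C0 : 0 < 1 + `|g r| by rewrite ltr_pwDl.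
have /cvgrPdist_le /(_ _ (divr_gt0 (divr_gt0 e0 (ltr0n _ 2)) C0)) := ch r r0T.
rewrite !near_withinE => hr.
have dr : \forall t \near r, `|r - t| < delta.
  by apply/nbhs_ballP; exists delta => //= t; rewrite -ball_normE.
move: r0T; rewrite /= in_itv/= => /andP[r0 rT].
near=> t; rewrite in_itv/= => /andP[t0 tT].
have rt : `|r - t| < delta by near: t.
have ght : `|g r * (h r - h t)| <= e / 2.
  have : `|h r - h t| <= e / 2 / (1 + `|g r|).
    have : `[0, T]%classic t -> `|h r - h t| <= e / 2 / (1 + `|g r|) by near: t.
    by apply; rewrite /= in_itv/= t0.
  rewrite ler_pdivlMr// normrM => hrt; apply: le_trans hrt.
  by rewrite mulrC ler_wpM2l// lerDr.
suff : `|Y r - Y t - g r * (h r - h t)| <= e / 2.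
  move=> Yrt.
  have -> : Y r - Y t = (Y r - Y t - g r * (h r - h t)) + g r * (h r - h t) by ring.
  by rewrite (le_trans (ler_normD _ _))// [e]splitr lerD.
have [tr|tr] := leP t r.
  by apply: Hd => //; rewrite -(ger0_norm (_ : 0 <= r - t)) ?subr_ge0.
have -> : Y r - Y t - g r * (h r - h t) = - (Y t - Y r - g r * (h t - h r)) by ring.
rewrite normrN; apply: Hd => //; first exact: ltW.
by rewrite -(gtr0_norm (_ : 0 < t - r)) ?subr_gt0// distrC.
Unshelve. all: by end_near. Qed.

(** * First order chain rule along the solution and decrease of the Lyapunov function *)

Section lyapunov.
Context {R : realType} (T : R) (c b x y F A h I : R -> R) (x0 : R).
Variable nu : R -> R -> R.
Hypothesis T0 : 0 < T.
Hypothesis cb : {within `[0, T], continuous b}.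
Hypothesis hy : forall t, 0 <= t -> t <= T -> is_RS_integral c b 0 t (y t).
Hypothesis hI : forall t, 0 <= t -> t <= T ->
  is_RS_integral (fun s => c s * x s) b 0 t (I t).
Hypothesis hx : forall t, 0 <= t -> t <= T -> x t = x0 + F t + I t.
Hypothesis cx : {within `[0, T], continuous x}.
Hypothesis FA : forall s t, 0 <= s -> s <= t -> t <= T -> `|F t - F s| <= A t - A s.
Hypothesis h_nd : forall s t, 0 <= s -> s <= t -> t <= T -> h s <= h t.
Hypothesis h_small : small_increments T (fun s t => h t - h s).
Hypothesis nu0 : negligible_sums T nu.
Hypothesis drift : forall s t, 0 <= s -> s <= t -> t <= T ->
  x s * (F t - F s) + x s ^+ 2 * (h t - h s) <= nu s t.

Let dX s t := x t - x s.
Let dY s t := y t - y s.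
Let dB s t := b t - b s.
Let dF s t := F t - F s.
Let dh s t := h t - h s.

Let x_bounded : exists K, forall t, 0 <= t -> t <= T -> `|x t| <= K.
Proof. exact: (continuous_bounded T0 cx). Qed.

Let boundl f : (exists K, forall t, 0 <= t -> t <= T -> `|f t| <= K) ->
  exists K, forall s t : R, 0 <= s -> s <= t -> t <= T -> `|f s : R| <= K.
Proof. by move=> [K HK]; exists K => s t s0 st tT; apply: HK => //; exact: le_trans tT. Qed.

Let boundr f : (exists K, forall t, 0 <= t -> t <= T -> `|f t| <= K) ->
  exists K, forall s t : R, 0 <= s -> s <= t -> t <= T -> `|f t : R| <= K.
Proof. by move=> [K HK]; exists K => s t s0 st tT; apply: HK => //; exact: le_trans st. Qed.

Let xs_negl phi : negligible_sums T phi -> negligible_sums T (fun s t => x s * phi s t).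
Proof. by have [K HK] := boundl x_bounded; exact: (negligible_sumsMl T0 HK). Qed.

Let xt_negl phi : negligible_sums T phi -> negligible_sums T (fun s t => x t * phi s t).
Proof. by have [K HK] := boundr x_bounded; exact: (negligible_sumsMl T0 HK). Qed.

Let cst_negl k phi : negligible_sums T phi -> negligible_sums T (fun s t => k * phi s t).
Proof. exact: (@negligible_sumsMl _ _ T0 `|k|). Qed.

Let smallX : small_increments T dX.
Proof. exact: (continuous_small_increments cx). Qed.

Let smallY : small_increments T dY.
Proof. apply: (continuous_small_increments (RS_integral_continuous T0 hy cb)). Qed.

Let smallM u phi : small_increments T u -> negligible_sums T phi ->
  negligible_sums T (fun s t => u s t * phi s t).
Proof. exact: negligible_sums_smallM. Qed.

Let errX s t := I t - I s - c s * x s * dB s t.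
Let errY s t := dY s t - c s * dB s t.

Let errX0 : negligible_sums T errX.
Proof.
by apply: (saks_henstock T0 hI (tag := fun s _ => s)) => s t st; rewrite lexx.
Qed.

Let errY0 : negligible_sums T errY.
Proof.
by apply: (saks_henstock T0 hy (tag := fun s _ => s)) => s t st; rewrite lexx.
Qed.

(** The difference of the Saks-Henstock estimates for [y] with left and with right tags. *)
Let dc_dB : negligible_sums T (fun s t => (c t - c s) * dB s t).
Proof.
have := saks_henstock T0 hy (tag := fun _ t => t)
  (fun s t st => introT andP (conj st (lexx t))).
move=> /(negligible_sumsB T0 errY0); apply: eq_negligible_sums => // s t *.
by rewrite /errY /dX /dY /dB /dF /dh; ring.
Qed.

Let dcx_dB : negligible_sums T (fun s t => (c t * x t - c s * x s) * dB s t).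
Proof.
have := saks_henstock T0 hI (tag := fun _ t => t)
  (fun s t st => introT andP (conj st (lexx t))).
move=> /(negligible_sumsB T0 errX0); apply: eq_negligible_sums => // s t *.
by rewrite /errX /dX /dY /dB /dF /dh; ring.
Qed.

(** Discrete product rule: [c s * dX] is the increment of [c * x] minus [x t * (c t - c s)]. *)
Let c_dX_dB : negligible_sums T (fun s t => c s * dX s t * dB s t).
Proof.
apply: eq_negligible_sums (negligible_sumsB T0 dcx_dB (xt_negl dc_dB)) => // s t *.
by rewrite /dX /dY /dB /dF /dh; ring.
Qed.

Let dX_eq s t : 0 <= s -> s <= t -> t <= T ->
  dX s t = dF s t + errX s t + c s * x s * dB s t.
Proof.
move=> s0 st tT; rewrite /errX /dX /dY /dB /dF /dh !hx//; first by ring.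
  exact: le_trans tT.
exact: le_trans st.
Qed.

Let small_dF u : small_increments T u -> negligible_sums T (fun s t => u s t * dF s t).
Proof. by move=> us; apply: (negligible_sums_small_bv T0 us FA). Qed.

Let small_dh u : small_increments T u -> negligible_sums T (fun s t => u s t * dh s t).
Proof.
move=> us; apply: (negligible_sums_small_bv (B := h) T0 us) => s t s0 st tT.
by rewrite ger0_norm// subr_ge0 h_nd.
Qed.

(** One factor [dX] is expanded by the equation. Its drift part has bounded variation, its error
    part is negligible, and its [dB] part is [x s] times the previous estimate. *)
Let dX_dX : negligible_sums T (fun s t => dX s t * dX s t).
Proof.
apply: eq_negligible_sums (negligible_sumsD (negligible_sumsD (small_dF smallX)
  (smallM smallX errX0)) (xs_negl c_dX_dB)) => // s t s0 st tT.
by rewrite [X in _ * X]dX_eq//; ring.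
Qed.

Let dX_dY : negligible_sums T (fun s t => dX s t * dY s t).
Proof.
apply: eq_negligible_sums (negligible_sumsD (smallM smallX errY0) c_dX_dB) => //.
by move=> s t *; rewrite /errY; ring.
Qed.

(** The factor [x s] is what allows the equation to be used: up to negligible terms [x s * dY] is
    [x s * c s * dB = dX - dF - errX], which reduces the claim to [dX * dY]. *)
Let x_dY_dY : negligible_sums T (fun s t => x s * (dY s t * dY s t)).
Proof.
apply: eq_negligible_sums (negligible_sumsD (xs_negl (smallM smallY errY0))
  (negligible_sumsB T0 dX_dY (negligible_sumsD (small_dF smallY)
  (smallM smallY errX0)))) => // s t s0 st tT.
by rewrite dX_eq// /errY; ring.
Qed.

Let W t := y t - h t.
Let dW s t := dY s t - dh s t.

Let smallW : small_increments T dW.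
Proof.
apply: small_incrementsD => // e /h_small[delta d0 Hd]; exists delta => // s t *.
by rewrite normrN Hd.
Qed.

Let dX_dW : negligible_sums T (fun s t => dX s t * dW s t).
Proof.
apply: eq_negligible_sums (negligible_sumsB T0 dX_dY (small_dh smallX)) => //.
by move=> s t *; rewrite /dW; ring.
Qed.

Let xt2_dW_dW : negligible_sums T (fun s t => x t ^+ 2 * (dW s t * dW s t)).
Proof.
(* First with both factors at the left end. The passage to [x t ^+ 2] costs [dX * (x s + x t)] times
   [dW * dW], where [dX * dW] is already negligible. *)
have xs2 : negligible_sums T (fun s t => x s * (x s * (dW s t * dW s t))).
  apply: xs_negl; apply: eq_negligible_sums (negligible_sumsB T0 x_dY_dY (negligible_sumsD
    (xs_negl (small_dh smallW)) (xs_negl (small_dh smallY)))) => // s t *.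
  by rewrite /dW; ring.
have dXW := smallM smallW dX_dW.
apply: eq_negligible_sums (negligible_sumsD xs2 (negligible_sumsD
  (xs_negl dXW) (xt_negl dXW))) => // s t *.
by rewrite /dX; ring.
Qed.

(** The Taylor remainder of the multiplicative increment of [expR (- 2 * W)]. *)
Let rho s t := expR (- 2 * dW s t) - 1 - (- 2 * dW s t).

Let xt2_rho : negligible_sums T (fun s t => x t ^+ 2 * rho s t).
Proof.
(* The bound 1/4 on [dW] puts [- 2 * dW] in the range of [expR_second_order], whose conclusion is
   then [8 * dW ^+ 2]. *)
have [delta d0 Hd] := smallW (ltac:(lra) : 0 < 4^-1 :> R).
apply: (negligible_sums_eventually T0 d0) (cst_negl 8 xt2_dW_dW) => s t s0 st tT ts.
have W4 := Hd _ _ s0 st tT ts.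
rewrite mulrCA !normrM ler_wpM2l//.
have : `|- 2 * dW s t| <= 2^-1.
  by rewrite normrM normrN (ger0_norm (ler0n _ 2)); move: W4; lra.
move=> /expR_second_order; rewrite -/(rho s t) => /le_trans; apply.
rewrite -normrM -expr2 (ger0_norm (sqr_ge0 _)) (ger0_norm (ler0n _ 8)).
by rewrite exprMn; lra.
Qed.

Let E t := expR (- 2 * W t).

Let E_bounded : exists K, forall t, 0 <= t -> t <= T -> `|E t| <= K.
Proof.
have [K HK] := continuous_bounded T0 (RS_integral_continuous T0 hy cb).
exists (expR (2 * (K + h T))) => t t0 tT; rewrite ger0_norm ?expR_ge0// ler_expR /W.
have := HK t t0 tT; have := h_nd t0 tT (lexx T); rewrite ler_norml => ? /andP[]; lra.
Qed.

(* Expanding [V = x^2 exp(2 h - 2 y)] to second order, all the second order terms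
   are negligible because [(dX)^2], [dX dY] and [x (dY)^2] are; the first order
   terms in [dB] cancel and what remains is the drift. *)
Lemma lyapunov_le :
  x T ^+ 2 * expR (- 2 * (y T - h T)) <= x 0 ^+ 2 * expR (- 2 * (y 0 - h 0)).
Proof.
pose second s t := dX s t * dX s t - 2 * (x t * (dX s t * dW s t) +
  x s * (dX s t * dW s t)) + x t ^+ 2 * rho s t.
pose first s t := nu s t + (x s * errX s t - x s * (x s * errY s t)).
have second0 : negligible_sums T second.
  apply: negligible_sumsD => //; apply: negligible_sumsB => //; apply: cst_negl.
  by apply: negligible_sumsD; [exact: xt_negl|exact: xs_negl].
have first0 : negligible_sums T first.
  apply: negligible_sumsD => //; apply: negligible_sumsB => //; first exact: xs_negl.
  by apply: xs_negl; exact: xs_negl.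
have [K HK] := boundl E_bounded.
apply: (@negligible_increments_le _ _ T0 (fun t => x t ^+ 2 * E t)
  (fun s t => E s * (2 * first s t + second s t))); last first.
  apply: (negligible_sumsMl T0 HK); apply: negligible_sumsD => //.
  exact: cst_negl.
move=> s t s0 st tT.
have -> : E t = E s * (1 - 2 * dW s t + rho s t).
  have -> : 1 - 2 * dW s t + rho s t = expR (- 2 * dW s t) by rewrite /rho; ring.
  by rewrite /E -expRD; congr expR; rewrite /W /dW /dX /dY /dB /dF /dh; ring.
have -> : x t ^+ 2 * (E s * (1 - 2 * dW s t + rho s t)) - x s ^+ 2 * E s =
    E s * (2 * (x s * (dX s t - x s * dY s t) + x s ^+ 2 * dh s t) + second s t).
  by rewrite /second /dW /dX; ring.
rewrite ler_wpM2l ?expR_ge0// lerD2r ler_wpM2l//.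
have -> : x s * (dX s t - x s * dY s t) + x s ^+ 2 * dh s t =
    x s * dF s t + x s ^+ 2 * dh s t + (x s * errX s t - x s * (x s * errY s t)).
  by rewrite dX_eq// /errY; ring.
by rewrite lerD2r; exact: drift.
Qed.

End lyapunov.

(** * From the pointwise condition on the drift to an inequality between increments *)

Section drift.
Context {R : realType} (T : R) (f x q h : R -> R).
Notation mu := (@lebesgue_measure R).
Hypothesis T0 : 0 < T.
Hypothesis f_int : mu.-integrable `[0, T] (EFin \o f).
Hypothesis cx : {within `[0, T], continuous x}.
Hypothesis q_ge0 : forall t, 0 <= t -> 0 <= q t.
Hypothesis q_nd : forall s t, 0 <= s -> s <= t -> q s <= q t.
Hypothesis h_le : forall s t, 0 <= s -> s <= t -> h t - h s <= q t * (t - s).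
Hypothesis f_le : forall r, 0 < r -> r <= T -> x r * f r <= - q r * x r ^+ 2.

Let f_int_sub s t : 0 <= s -> t <= T -> mu.-integrable `]s, t] (EFin \o f).
Proof.
move=> s0 tT; apply: integrableS f_int => //.
by apply: subset_itv; rewrite bnd_simp.
Qed.

Lemma Rintegral_increment g s t : mu.-integrable `[0, T] (EFin \o g) ->
  0 <= s -> s <= t -> t <= T ->
  (\int[mu]_(r in `[0%R, t]) g r) - (\int[mu]_(r in `[0%R, s]) g r) =
  \int[mu]_(r in `]s, t]) g r.
Proof.
move=> g_int s0 st tT; rewrite Rintegral_itvB ?bnd_simp//.
by apply: integrableS g_int => //; apply: subset_itv; rewrite bnd_simp.
Qed.

(** On a short interval [x s * f r] is [x r * f r] up to a small multiple of [|f r|], and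
    [x r * f r <= - q r * x r ^+ 2] then compensates the increment of [h], whose slope is at most
    [q t]. What is left over is small relative to the increments of [A], [q] and [t]. *)
Lemma drift_negligible : exists2 nu, negligible_sums T nu &
  forall s t, 0 <= s -> s <= t -> t <= T ->
  x s * ((\int[mu]_(r in `[0%R, t]) f r) - (\int[mu]_(r in `[0%R, s]) f r)) +
  x s ^+ 2 * (h t - h s) <= nu s t.
Proof.
pose phi s t := x s * ((\int[mu]_(r in `[0%R, t]) f r) -
  (\int[mu]_(r in `[0%R, s]) f r)) + x s ^+ 2 * (h t - h s).
(* Only an upper bound on [phi] is available, so its positive part is what can be negligible. *)
exists (fun s t => Num.max 0 (phi s t)); last first.
  by move=> s t *; rewrite le_max lexx orbT.
have [K HK] := continuous_bounded T0 cx.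
have K0 : 0 <= K by rewrite (le_trans _ (HK 0 (lexx 0) (ltW T0))).
pose A t := \int[mu]_(r in `[0%R, t]) `|f r|.
have absf_int : mu.-integrable `[0, T] (EFin \o (fun r => `|f r|)).
  exact: (integrable_norm f_int).
have fE0 := continuous_small_increments cx.
(* The three summands are the coefficients of the increments of [A], [q] and [t] in the final
   estimate; their sum dominates each of them. *)
have C0 : 0 < 1 + K ^+ 2 + 2 * K * q T.
  by rewrite -addrA ltr_pwDl// addr_ge0 ?sqr_ge0// !mulr_ge0// q_ge0// ltW.
set C := 1 + K ^+ 2 + 2 * K * q T in C0.
apply: (negligible_sums_rate T0 (B := fun t => A t + q t + t)) => e e0.
have eC0 : 0 < e / C by rewrite divr_gt0.
have [d d0 Hd] := fE0 _ eC0.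
(* The length is also kept below [e / C] to absorb [(q t - q s) * (t - s)]: the drift is estimated
   with [q] at the left end, the increment of [h] with [q] at the right end. *)
exists (Num.min d (e / C)); first by rewrite lt_min d0.
move=> s t s0 st tT; rewrite lt_min => /andP[tsd tse].
have sT := le_trans st tT; have t0 := le_trans s0 st.
have dA : A t - A s = \int[mu]_(r in `]s, t]) `|f r| by exact: Rintegral_increment.
have dA0 : 0 <= A t - A s by rewrite dA Rintegral_ge0.
have dq0 : 0 <= q t - q s by rewrite subr_ge0 q_nd.
have dt0 : 0 <= t - s by rewrite subr_ge0.
rewrite ger0_norm ?le_max ?lexx// ge_max; apply/andP; split.
  by rewrite mulr_ge0 ?(ltW e0)//; lra.
set e' := e / C in eC0 Hd tse *.
have -> : e = e' * C by rewrite divfK// gt_eqF.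
have xsK := HK _ s0 sT.
have xs2 : x s ^+ 2 <= K ^+ 2 by rewrite -real_normK ?num_real// ler_sqr ?nnegrE.
have qsT : q s <= q T by exact: q_nd.
have qs0 := q_ge0 s0.
(* A lower bound of [q r * x r ^+ 2] for [r] in []s, t]], since [q] is nondecreasing and [x r ^+ 2]
   is within [2 * K * e'] of [x s ^+ 2]. *)
pose k := q s * (x s ^+ 2 - 2 * K * e').
have main : x s * \int[mu]_(r in `]s, t]) f r <= e' * (A t - A s) - k * (t - s).
  rewrite -RintegralZl//; last exact: f_int_sub.
  have absf_int_st : mu.-integrable `]s, t] (EFin \o (fun r => `|f r|)).
    exact: (integrable_norm (f_int_sub s0 tT)).
  have k_int : mu.-integrable `]s, t] (EFin \o cst k).
    apply: measurable_bounded_integrable => //; last exact: bounded_cst.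
    by rewrite /= lebesgue_measure_itv/=; case: ifPn => // _; rewrite -EFinB ltry.
  have ef_int : mu.-integrable `]s, t] (EFin \o (fun r => e' * `|f r|)).
    by under [X in _.-integrable _ X]funext do rewrite /= EFinM; exact: integrableZl.
  have -> : e' * (A t - A s) - k * (t - s) = \int[mu]_(r in `]s, t]) (e' * `|f r| - k).
    rewrite RintegralB// RintegralZl// dA Rintegral_cst//= lebesgue_measure_itv/= lte_fin.
    by case: ltP => [//|ts]; have -> : t = s; [exact/le_anti/andP|rewrite subrr].
  apply: le_Rintegral => //.
  - under [X in _.-integrable _ X]funext do rewrite /= EFinM.
    by apply: integrableZl => //; exact: f_int_sub.
  - exact: (integrableB _ ef_int k_int).
  - move=> r; rewrite /= in_itv/= => /andP[sr rt].
    have r0 := le_lt_trans s0 sr; have rT := le_trans rt tT.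
    have xrK := HK _ (ltW r0) rT.
    have xsr : `|x r - x s| <= e'.
      apply: Hd => //; first exact: ltW.
      by rewrite (le_lt_trans _ tsd)// lerB.
    have fr := f_le r0 rT.
    have qsr := q_nd s0 (ltW sr).
    have h1 : (x s - x r) * f r <= e' * `|f r|.
      by rewrite (le_trans (ler_norm _))// normrM distrC ler_wpM2r.
    have h2 : x s ^+ 2 - 2 * K * e' <= x r ^+ 2.
      have -> : x s ^+ 2 = x r ^+ 2 + (x s - x r) * (x s + x r) by ring.
      suff : (x s - x r) * (x s + x r) <= e' * (2 * K) by lra.
      rewrite (le_trans (ler_norm _))// normrM ler_pM//; first by rewrite distrC.
      by rewrite (le_trans (ler_normD _ _))//; lra.
    have h3 : q s * (x s ^+ 2 - 2 * K * e') <= q r * x r ^+ 2.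
      apply: (@le_trans _ _ (q s * x r ^+ 2)); first by rewrite ler_wpM2l.
      by rewrite ler_wpM2r// sqr_ge0.
    rewrite /k; have -> : x s * f r = x r * f r + (x s - x r) * f r by ring.
    by lra.
rewrite /phi Rintegral_increment//.
have dh : x s ^+ 2 * (h t - h s) <= x s ^+ 2 * (q t * (t - s)).
  by rewrite ler_wpM2l ?sqr_ge0// h_le.
have i1 : x s ^+ 2 * ((q t - q s) * (t - s)) <= K ^+ 2 * ((q t - q s) * e').
  by rewrite ler_pM ?sqr_ge0 ?mulr_ge0// ler_wpM2l// ltW.
have e'0 := ltW eC0.
have i2 : 2 * K * e' * q s * (t - s) <= 2 * K * e' * q T * (t - s).
  by rewrite ler_wpM2r// ler_wpM2l// mulr_ge0// mulr_ge0.
apply: (@le_trans _ _ (e' * (A t - A s) + K ^+ 2 * ((q t - q s) * e') +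
  2 * K * e' * q T * (t - s))).
  by move: main dh i1 i2; rewrite /k; lra.
have qT0 : 0 <= q T by exact: q_ge0 (ltW T0).
have -> : e' * (A t - A s) + K ^+ 2 * ((q t - q s) * e') + 2 * K * e' * q T * (t - s) =
  e' * ((A t - A s) + K ^+ 2 * (q t - q s) + 2 * K * q T * (t - s)) by ring.
rewrite -[leRHS]mulrA ler_wpM2l// /C.
have K20 := sqr_ge0 K; have KqT : 0 <= 2 * K * q T by rewrite !mulr_ge0.
have : 0 <= K ^+ 2 * (A t - A s) by rewrite mulr_ge0.
have : 0 <= K ^+ 2 * (t - s) by rewrite mulr_ge0.
have : 0 <= 2 * K * q T * (A t - A s) by rewrite mulr_ge0.
have : 0 <= 2 * K * q T * (q t - q s) by rewrite mulr_ge0.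
lra.
Qed.

End drift.

(** Mean value theorem with a nondecreasing derivative. The case [s = 0] is treated by hand because
    the derivative of the power is taken at positive points. *)
Lemma powR_increment_le {R : realType} (kappa s t : R) : 1 < kappa ->
  0 <= s -> s <= t -> t `^ kappa - s `^ kappa <= kappa * t `^ (kappa - 1) * (t - s).
Proof.
move=> k1; have k0 : 0 < kappa by exact: lt_trans k1.
rewrite le_eqVlt => /predU1P[<-|s0] st.
  rewrite powR0 ?gt_eqF// !subr0 -mulrA [_ * t]mulrC mulr_powRB1//.
  by rewrite ler_peMl ?powR_ge0// ltW.
have dpow (r : R) : 0 < r -> is_derive r 1 (@powR R ^~ kappa) (kappa * r `^ (kappa - 1)).
  by move=> r0; exact: is_derive1_powR.
have cpow : {within `[s, t], continuous (@powR R ^~ kappa)}.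
  apply: derivable_within_continuous => r; rewrite in_itv/= => /andP[sr _].
  by have := dpow r (lt_le_trans s0 sr) => /@ex_derive.
have dpow_itv (r : R) : r \in `]s, t[ ->
    is_derive r 1 (@powR R ^~ kappa) (kappa * r `^ (kappa - 1)).
  by rewrite in_itv/= => /andP[sr _]; apply: dpow; exact: lt_trans sr.
have [r] := MVT_segment st dpow_itv cpow.
rewrite in_itv/= => /andP[sr rt] ->.
rewrite ler_wpM2r ?subr_ge0// ler_wpM2l ?(ltW k0)//.
have r0 : 0 < r by exact: lt_le_trans sr.
by apply: ge0_ler_powR; rewrite ?nnegrE ?subr_ge0 ?(ltW k1) ?(ltW r0)// (le_trans (ltW r0)).
Qed.

(** [lyapunov_le] for [h t = lambda * t ^ kappa], with [q] the derivative of [h]. Since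
    [y 0 = h 0 = 0], taking square roots gives the bound. *)
Lemma pathwise_bound {R : realType} (T lambda kappa x0 : R) (b c x y f I : R -> R) :
  0 < T -> 0 < lambda -> 1 < kappa ->
  {within `[0, T], continuous b} ->
  (forall t, 0 <= t -> t <= T -> is_RS_integral c b 0 t (y t)) ->
  (forall t, 0 <= t -> t <= T -> is_RS_integral (fun s => c s * x s) b 0 t (I t)) ->
  lebesgue_measure.-integrable `[0, T] (EFin \o f) ->
  (forall t, 0 <= t -> t <= T ->
    x t = x0 + \int[lebesgue_measure]_(s in `[0, t]) f s + I t) ->
  (forall r, 0 < r -> r <= T ->
    x r * f r <= - lambda * kappa * r `^ (kappa - 1) * x r ^+ 2) ->
  `|x T| <= `|x0| * expR (- lambda * T `^ kappa + y T).
Proof.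
move=> T0 l0 k1 cb hy hI f_int hx f_le.
have k0 : 0 < kappa by exact: lt_trans k1.
pose F t := \int[lebesgue_measure]_(s in `[0%R, t]) f s.
pose A t := \int[lebesgue_measure]_(s in `[0%R, t]) `|f s|.
pose h t := lambda * t `^ kappa.
pose q t := lambda * kappa * t `^ (kappa - 1).
have cF : {within `[0, T], continuous F}.
  exact: (parameterized_integral_continuous (ltW T0) f_int).
have cx : {within `[0, T], continuous x}.
  apply: (@subspace_eq_continuous _ _ _ (fun t => x0 + F t + I t)).
    by move=> t; rewrite inE /= in_itv/= => /andP[t0 tT]; rewrite /from_subspace hx.
  move=> t; apply: cvgD; last exact: (RS_integral_continuous T0 hI cb).
  by apply: cvgD; [exact: cvg_cst|exact: cF].
have absf_int : lebesgue_measure.-integrable `[0, T] (EFin \o (fun r => `|f r|)).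
  exact: (integrable_norm f_int).
have FA s t : 0 <= s -> s <= t -> t <= T -> `|F t - F s| <= A t - A s.
  move=> s0 st tT; rewrite (Rintegral_increment f_int)// (Rintegral_increment absf_int)//.
  apply: le_normr_Rintegral => //; apply: integrableS f_int => //.
  by apply: subset_itv; rewrite bnd_simp.
have q_ge0 t : 0 <= t -> 0 <= q t.
  by move=> _; rewrite !mulr_ge0 ?powR_ge0// ltW.
have q_nd s t : 0 <= s -> s <= t -> q s <= q t.
  move=> s0 st; rewrite ler_wpM2l ?mulr_ge0 ?(ltW l0) ?(ltW k0)//.
  by apply: ge0_ler_powR; rewrite ?nnegrE ?subr_ge0 ?(ltW k1)// (le_trans s0).
have h_nd s t : 0 <= s -> s <= t -> h s <= h t.
  move=> s0 st; rewrite ler_wpM2l ?(ltW l0)//.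
  by apply: ge0_ler_powR; rewrite ?nnegrE ?(ltW k0)// (le_trans s0).
have h_le s t : 0 <= s -> s <= t -> h t - h s <= q t * (t - s).
  move=> s0 st; rewrite /h /q -mulrBr -!mulrA ler_wpM2l ?(ltW l0)// mulrA.
  exact: powR_increment_le.
have h_small : small_increments T (fun s t => h t - h s).
  move=> e e0; have qT0 : 0 < 1 + q T by rewrite ltr_pwDl// q_ge0// ltW.
  exists (e / (1 + q T)); first by rewrite divr_gt0.
  move=> s t s0 st tT; rewrite ltr_pdivlMr// => tse.
  rewrite ger0_norm ?subr_ge0 ?h_nd// (le_trans (h_le _ _ s0 st))//.
  rewrite (le_trans _ (ltW tse))// mulrC ler_wpM2l ?subr_ge0//.
  by rewrite (le_trans (q_nd _ _ (le_trans s0 st) tT))// lerDr.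
have f_le' r : 0 < r -> r <= T -> x r * f r <= - q r * x r ^+ 2.
  by move=> r0 rT; rewrite (le_trans (f_le r r0 rT))// /q !mulNr.
have [nu nu0 drift] := drift_negligible T0 f_int cx q_ge0 q_nd h_le f_le'.
have h_nd' s t : 0 <= s -> s <= t -> t <= T -> h s <= h t by move=> *; exact: h_nd.
have := lyapunov_le T0 cb hy hI hx cx FA h_nd' h_small nu0 drift.
have y0 := RS_integral_at0 T0 hy; have I0 := RS_integral_at0 T0 hI.
have -> : x 0 = x0.
  by rewrite hx ?(ltW T0)// I0 set_itv1 Rintegral_set1 !addr0.
rewrite y0 {2}/h powR0 ?gt_eqF// mulr0 subr0 mulr0 expR0 mulr1 => le2.
have e2 : expR (- 2 * (y T - h T)) = expR (- (- lambda * T `^ kappa + y T)) ^+ 2.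
  by rewrite expr2 -expRD; congr expR; rewrite /h; ring.
move: le2; rewrite e2 -exprMn -[leRHS]real_normK ?num_real//.
rewrite -[leLHS]real_normK ?num_real// ler_sqr ?nnegrE// normrM.
by rewrite (gtr0_norm (expR_gt0 _)) expRN ler_pdivrMr ?expR_gt0.
Qed.

(** * Exponential moments of Gaussian variables *)

Section normal_integrals.
Context {R : realType}.
Notation mu := (@lebesgue_measure R).

(** The Radon-Nikodym derivative and [normal_pdf] have the same integral over every measurable set,
    hence agree almost everywhere. *)
Lemma ge0_integral_normal_prob (m s : R) (f : R -> \bar R) :
  measurable_fun setT f -> (forall x, (0 <= f x)%E) ->
  (\int[normal_prob m s]_x f x = \int[mu]_x (f x * (normal_pdf m s x)%:E))%E.
Proof.
move=> mf f0.
have dom : normal_prob m s `<< mu by exact: normal_prob_dominates.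
rewrite -(Radon_Nikodym_SigmaFinite.change_of_variables dom)//.
have gint := Radon_Nikodym_SigmaFinite.f_integrable dom.
apply: ae_eq_integral => //.
- by apply: emeasurable_funM => //; exact: (measurable_int _ gint).
- apply: emeasurable_funM => //; apply/measurable_EFinP.
  exact: measurable_normal_pdf.
- apply: ae_eqe_mul2l; apply: integral_ae_eq => //.
    by apply/measurable_EFinP; exact: measurable_normal_pdf.
  by move=> A _ mA; rewrite -Radon_Nikodym_SigmaFinite.f_integral.
Qed.

(** Completing the square: the exponential factor shifts the mean of the density to
    [m + a * s ^+ 2]. *)
Lemma normal_integral_expR (m s a : R) : s != 0 ->
  (\int[normal_prob m s]_x (expR (a * x))%:E =
   (expR (a * m + a ^+ 2 * s ^+ 2 / 2))%:E)%E.
Proof.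
move=> s0; rewrite ge0_integral_normal_prob//; last first.
  by apply/measurable_EFinP/measurableT_comp => //; exact: measurable_funM.
rewrite (eq_integral (fun x : measurableTypeR R => (expR (a * m + a ^+ 2 * s ^+ 2 / 2))%:E *
    (normal_pdf (m + a * s ^+ 2) s x)%:E)%E); last first.
  move=> x _; rewrite -!EFinM; congr EFin; rewrite !normal_pdfE// mulrCA [RHS]mulrCA.
  congr (_ * _); rewrite /normal_fun -!expRD; congr expR.
  by rewrite -mulr_natr; field; rewrite s0.
rewrite ge0_integralZl_EFin ?expR_ge0//; last first.
- by apply/measurable_EFinP; exact: measurable_normal_pdf.
- by move=> x _; rewrite lee_fin normal_pdf_ge0.
by rewrite integral_normal_pdf mule1.
Qed.

(** The factor [expR (- b * x ^+ 2)] shrinks the standard deviation of the density from [s] to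
    [s / D], and the change of its peak leaves the constant [D^-1]. *)
Lemma normal_integral_gauss (s b : R) : s != 0 -> 0 <= b ->
  (\int[normal_prob 0 s]_x (expR (- b * x ^+ 2))%:E =
   ((Num.sqrt (1 + 2 * b * s ^+ 2))^-1)%:E)%E.
Proof.
move=> s0 b0; rewrite ge0_integral_normal_prob//; last first.
  apply/measurable_EFinP/measurableT_comp => //.
  by apply: measurable_funM => //; exact: measurable_funX.
have s2 : 0 < s ^+ 2 by rewrite exprn_even_gt0.
have d0 : 0 < 1 + 2 * b * s ^+ 2.
  by apply: ltr_pwDl => //; apply: mulr_ge0; [apply: mulr_ge0|exact: ltW].
pose D := Num.sqrt (1 + 2 * b * s ^+ 2).
have D0 : 0 < D by rewrite sqrtr_gt0.
have D2 : D ^+ 2 = 1 + 2 * b * s ^+ 2 by rewrite sqr_sqrtr// ltW.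
rewrite -/D; clearbody D.
have sD0 : s / D != 0 by rewrite mulf_neq0// invr_eq0 gt_eqF.
rewrite (eq_integral (fun x : measurableTypeR R =>
    (D^-1)%:E * (normal_pdf 0 (s / D) x)%:E)%E); last first.
  move=> x _; rewrite -!EFinM; congr EFin; rewrite !normal_pdfE// mulrCA [RHS]mulrA.
  congr (_ * _).
    rewrite /normal_peak -invfM; congr (_^-1).
    have DS : D = Num.sqrt (D ^+ 2) by rewrite sqrtr_sqr gtr0_norm.
    rewrite [X in _ = X * _]DS -sqrtrM ?sqr_ge0//.
    congr Num.sqrt; rewrite -[in RHS]mulrnAr mulrA expr_div_n [D ^+ 2 * _]mulrC divfK//.
      exact/esym/mulrnAr.
    by rewrite sqrf_eq0 gt_eqF.
  rewrite /normal_fun -!expRD; congr expR.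
  rewrite !subr0 expr_div_n D2 !mulr2n; field.
  by rewrite !gt_eqF// addr_gt0.
rewrite ge0_integralZl_EFin ?invr_ge0 ?ltW//; last first.
- by apply/measurable_EFinP; exact: measurable_normal_pdf.
- by move=> x _; rewrite lee_fin normal_pdf_ge0.
by rewrite integral_normal_pdf mule1.
Qed.

End normal_integrals.

Section gaussian_moments.
Context {d : measure_display} {T : measurableType d} {R : realType}.
Variables (P : probability T R) (Y : T -> R).
Hypothesis mY : measurable_fun setT Y.

(** The law enters the sequel through these two formulas. They also hold for the Dirac mass, with
    [s = 0], so the degenerate case is not met again. *)
Lemma gaussian_integral : gaussian P Y -> exists m s : R,
  (forall a, (\int[P]_w (expR (a * Y w))%:E =
    (expR (a * m + a ^+ 2 * s ^+ 2 / 2))%:E)%E) /\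
  (forall b, 0 <= b -> m = 0 -> (\int[P]_w (expR (- b * Y w ^+ 2))%:E =
    ((Num.sqrt (1 + 2 * b * s ^+ 2))^-1)%:E)%E).
Proof.
move=> [m [s law]]; exists m, s.
have mexp a : measurable_fun setT (fun x : R => (expR (a * x))%:E).
  by apply/measurable_EFinP/measurableT_comp => //; exact: measurable_funM.
have mgauss b : measurable_fun setT (fun x : R => (expR (- b * x ^+ 2))%:E).
  apply/measurable_EFinP/measurableT_comp => //.
  by apply: measurable_funM => //; exact: measurable_funX.
pose Z : T -> measurableTypeR R := Y.
have mZ : measurable_fun setT Z by exact: mY.
have push (f : measurableTypeR R -> \bar R) : measurable_fun setT f ->
    (forall x, 0 <= f x)%E -> (\int[P]_w f (Y w) = \int[pushforward P Z]_x f x)%E.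
  by move=> mf f0; rewrite ge0_integral_pushforward.
have [s0|s0] := eqVneq s 0.
  have dir (f : R -> \bar R) : measurable_fun setT f -> (forall x, 0 <= f x)%E ->
      (\int[P]_w f (Y w) = f m)%E.
    move=> mf f0; rewrite (push f)// (eq_measure_integral (\d_(m : measurableTypeR R))).
      by rewrite integral_dirac// diracT mul1e.
    by move=> A mA _; rewrite /= /pushforward law// s0 eqxx.
  split=> [a|b b0 m0].
    rewrite (dir (fun x => (expR (a * x))%:E))//.
    by rewrite s0 expr0n/= mulr0 mul0r addr0.
  rewrite (dir (fun x => (expR (- b * x ^+ 2))%:E))//.
  by rewrite s0 m0 expr0n/= !mulr0 addr0 expR0 sqrtr1 invr1.
have nor (f : R -> \bar R) : measurable_fun setT f -> (forall x, 0 <= f x)%E ->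
    (\int[P]_w f (Y w) = \int[normal_prob m s]_x f x)%E.
  move=> mf f0; rewrite (push f)// (eq_measure_integral (normal_prob m s))//.
  by move=> A mA _; rewrite /= /pushforward law// (negbTE s0).
split=> [a|b b0 m0].
  rewrite (nor (fun x => (expR (a * x))%:E))//.
  exact: normal_integral_expR.
rewrite (nor (fun x => (expR (- b * x ^+ 2))%:E))//.
by rewrite m0; exact: normal_integral_gauss.
Qed.

(* The bound on the exponential moments needs only two inequalities on the
   parameters m and s of the law: [1 <= E exp(aY)] for all a forces [m = 0], and
   [1 - b E Y^2 <= E exp(- b Y^2) = (1 + 2 b s^2)^(-1/2)] as [b] tends to 0 gives
   [s^2 <= E Y^2]. *)
Lemma gaussian_expR_moment (v a : R) : gaussian P Y ->
  P.-integrable setT (EFin \o Y) -> (\int[P]_w (Y w)%:E = 0)%E ->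
  (\int[P]_w ((Y w) ^+ 2)%:E <= v%:E)%E ->
  (\int[P]_w (expR (a * Y w))%:E <= (expR (a ^+ 2 * v / 2))%:E)%E.
Proof.
move=> gY iY EY EY2; have [m [s [mgf gau]]] := gaussian_integral gY.
have mgf_ge1 r : 0 <= r * m + r ^+ 2 * s ^+ 2 / 2.
  rewrite -ler_expR expR0 -lee_fin -mgf.
  have i1 : P.-integrable setT (EFin \o cst (1 : R)).
    exact: finite_measure_integrable_cst.
  have irY : P.-integrable setT (EFin \o (fun w => r * Y w)).
    by under [X in _.-integrable _ X]funext do rewrite /= EFinM; exact: integrableZl.
  have -> : 1%:E = (\int[P]_w (1 + r * Y w)%:E)%E.
    rewrite (integralD_EFin _ i1 irY)//= integral_cst//= probability_setT mule1.
    under eq_integral do rewrite EFinM.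
    by rewrite integralZl// EY mule0 adde0.
  apply: le_integral => //.
  - exact: (integrableD _ i1 irY).
  - apply/integrableP; split.
      by apply/measurable_EFinP/measurableT_comp => //; exact: measurable_funM.
    under eq_integral do rewrite gee0_abs ?lee_fin ?expR_ge0//.
    by rewrite mgf ltry.
  - by move=> w _; rewrite lee_fin expR_ge1Dx.
have m0 : m = 0.
  have t0 : 0 < 1 + s ^+ 2 by rewrite ltr_pwDl// sqr_ge0.
  (* At this point the quadratic [r * m + r ^+ 2 * s ^+ 2 / 2] is negative unless [m = 0]; the added
     1 avoids a division by zero. *)
  have := mgf_ge1 (- m / (1 + s ^+ 2)).
  have -> : - m / (1 + s ^+ 2) * m + (- m / (1 + s ^+ 2)) ^+ 2 * s ^+ 2 / 2 =
    - (m ^+ 2 * (1 + s ^+ 2 / 2) / (1 + s ^+ 2) ^+ 2).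
    by field; rewrite gt_eqF.
  rewrite oppr_ge0 pmulr_lle0 ?invr_gt0 ?exprn_gt0// pmulr_lle0; last first.
    by rewrite ltr_pwDl// divr_ge0 ?sqr_ge0.
  by move=> m2; apply/eqP; rewrite -sqrf_eq0 eq_le m2 sqr_ge0.
have v0 : 0 <= v.
  by rewrite -lee_fin (le_trans _ EY2)// integral_ge0// => w _; rewrite lee_fin sqr_ge0.
have mY2 : measurable_fun setT (fun w => (Y w ^+ 2)%:E).
  by apply/measurable_EFinP; exact: measurable_funX.
have iY2 : P.-integrable setT (EFin \o (fun w => Y w ^+ 2)).
  apply/integrableP; split=> //.
  under eq_integral do rewrite gee0_abs ?lee_fin ?sqr_ge0//.
  by rewrite (le_lt_trans EY2)// ltry.
have key b : 0 < b -> b * v <= 1 -> s ^+ 2 - v <= 2 * b * v * s ^+ 2.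
  move=> b0 bv1; pose D := Num.sqrt (1 + 2 * b * s ^+ 2).
  have bs0 : 0 <= 2 * b * s ^+ 2.
    by apply: mulr_ge0; [apply: mulr_ge0 => //; exact: ltW|exact: sqr_ge0].
  have D0 : 0 < D by rewrite sqrtr_gt0 ltr_pwDl.
  have D2 : D ^+ 2 = 1 + 2 * b * s ^+ 2 by rewrite sqr_sqrtr// addr_ge0.
  have : 1 - b * v <= D^-1.
    rewrite -lee_fin -(gau b (ltW b0) m0).
    have i1 : P.-integrable setT (EFin \o cst (1 : R)).
      exact: finite_measure_integrable_cst.
    have ibY : P.-integrable setT (EFin \o (fun w => b * Y w ^+ 2)).
      by under [X in _.-integrable _ X]funext do rewrite /= EFinM; exact: integrableZl.
    apply: (@le_trans _ _ (\int[P]_w (1 - b * Y w ^+ 2)%:E)%E).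
      rewrite (integralB_EFin _ i1 ibY)//= integral_cst//= probability_setT mule1.
      under [X in (_ - X)%E]eq_integral do rewrite EFinM.
      rewrite integralZl// EFinB leeB// EFinM.
      by rewrite lee_wpmul2l// lee_fin ltW.
    apply: le_integral => //.
    - exact: (integrableB _ i1 ibY).
    - apply: le_integrable i1 => //.
        apply/measurable_EFinP/measurableT_comp => //.
        by apply: measurable_funM => //; exact: measurable_funX.
      move=> w _; rewrite /= lee_fin normr1 ger0_norm ?expR_ge0// -[leRHS]expR0 ler_expR.
      by rewrite mulNr oppr_le0 mulr_ge0 ?sqr_ge0// ltW.
    - by move=> w _; rewrite lee_fin mulNr; exact: expR_ge1Dx.
  rewrite -(ler_pM2r D0) mulVf ?gt_eqF// => D1.
  have : ((1 - b * v) * D) ^+ 2 <= 1.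
    by rewrite -[leRHS](expr1n _ 2) ler_sqr ?nnegrE// mulr_ge0 ?subr_ge0// ltW.
  rewrite exprMn D2 => {}D1.
  (* Dropping [(b * v) ^+ 2] from the squared inequality leaves, after division by [2 * b], the
     bound claimed in [key]. *)
  have : (1 - 2 * (b * v)) * (1 + 2 * b * s ^+ 2) <= 1.
    apply: le_trans D1; rewrite ler_wpM2r ?addr_ge0//.
    by rewrite sqrrB expr1n mul1r mulr_natl lerDl sqr_ge0.
  move=> le1; have : 2 * b * (s ^+ 2 - v - 2 * b * v * s ^+ 2) <= 0 by lra.
  by rewrite pmulr_rle0 ?subr_le0// mulr_gt0.
have sv : s ^+ 2 <= v.
  rewrite leNgt; apply/negP => vs.
  have v1 : 0 < 1 + v by rewrite ltr_pwDl.
  have s1 : 0 < 1 + s ^+ 2 by rewrite ltr_pwDl// sqr_ge0.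
  have D0 : 0 < s ^+ 2 - v by rewrite subr_gt0.
  have vs1 : 0 < 2 * ((1 + v) * (1 + s ^+ 2)) by rewrite !mulr_gt0.
  (* This [b] is small enough for [b * v <= 1], and makes the right side of [key] smaller than
     [s ^+ 2 - v] because [v * s ^+ 2 < (1 + v) * (1 + s ^+ 2)]. *)
  have := key ((s ^+ 2 - v) / (2 * ((1 + v) * (1 + s ^+ 2)))).
  have vs0 : 0 <= v * s ^+ 2 by rewrite mulr_ge0// sqr_ge0.
  have b0 : 0 < (s ^+ 2 - v) / (2 * ((1 + v) * (1 + s ^+ 2))) by rewrite divr_gt0.
  move=> /(_ b0); have -> : (s ^+ 2 - v) / (2 * ((1 + v) * (1 + s ^+ 2))) * v <= 1.
    by rewrite mulrAC ler_pdivrMr// mul1r; have := sqr_ge0 v; lra.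
  move=> /(_ isT).
  have -> : 2 * ((s ^+ 2 - v) / (2 * ((1 + v) * (1 + s ^+ 2)))) * v * s ^+ 2 =
    (s ^+ 2 - v) * (v * s ^+ 2 / ((1 + v) * (1 + s ^+ 2))).
    by field; rewrite !gt_eqF.
  rewrite -{1}[s ^+ 2 - v]mulr1 ler_pM2l// ler_pdivlMr ?mulr_gt0// mul1r.
  by have := sqr_ge0 s; lra.
by rewrite mgf m0 mulr0 add0r lee_fin ler_expR ler_wpM2r// ler_wpM2l// sqr_ge0.
Qed.

End gaussian_moments.

(** * Riemann sums of a fractional Brownian motion *)

(** Convexity of the power at the midpoint [x] of [x + e] and [x - e]. It yields the nonnegative
    correlation of the increments of [B]. *)
Lemma norm_powR_midpoint {R : realType} (r x e : R) : 1 <= r ->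
  2 * `|x| `^ r <= `|x + e| `^ r + `|x - e| `^ r.
Proof.
move=> r1; have r0 : 0 <= r by exact: le_trans r1.
have le1 : `|x| <= 2^-1 * `|x + e| + 2^-1 * `|x - e|.
  have : `|2 * x| <= `|x + e| + `|x - e|.
    have -> : 2 * x = (x + e) + (x - e) by ring.
    exact: ler_normD.
  by rewrite normrM ger0_norm//; lra.
have : `|x| `^ r <= 2^-1 * `|x + e| `^ r + 2^-1 * `|x - e| `^ r; last by lra.
apply: (@le_trans _ _ ((2^-1 * `|x + e| + 2^-1 * `|x - e|) `^ r)).
  by apply: ge0_ler_powR => //; rewrite nnegrE// addr_ge0// mulr_ge0.
have {2 4}-> : 2^-1 = 1 - 2^-1 :> R by lra.
by apply: (convex_powR r1 (Itv01 _ _)) => //=;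
  rewrite ?inE/= ?in_itv/= ?normr_ge0// ?invr_ge0// invf_le1 ?ler1n.
Qed.

Definition fbm_cov {R : realType} (H t s : R) : R :=
  2^-1 * (t `^ (2 * H) + s `^ (2 * H) - `|t - s| `^ (2 * H)).

Section fractional_brownian_sums.
Context {R : realType} {d : measure_display} {Omega : measurableType d}.
Variables (P : probability Omega R) (H : R) (B : R -> {RV P >-> R}).
Hypothesis hH : 2^-1 < H.
Hypothesis hB : fractional_brownian_motion H B.

Let mB t : measurable_fun setT (B t : Omega -> R).
Proof. exact: measurable_funP. Qed.

Lemma fbm_integrable_sqr t : 0 <= t ->
  P.-integrable setT (EFin \o (fun w => B t w ^+ 2)).
Proof.
move=> t0; have [_ _ cov _] := hB.
have := cov t t t0 t0; rewrite unlock => E2.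
apply/integrableP; split; first by apply/measurable_EFinP; exact: measurable_funX.
under eq_integral do rewrite /= ger0_norm ?sqr_ge0// expr2.
by rewrite E2 ltry.
Qed.

Lemma fbm_integrableM t s : 0 <= t -> 0 <= s ->
  P.-integrable setT (EFin \o (fun w => B t w * B s w)).
Proof.
move=> t0 s0.
have := integrableD measurableT (fbm_integrable_sqr t0) (fbm_integrable_sqr s0).
apply: le_integrable => //.
  by apply/measurable_EFinP; exact: measurable_funM.
move=> w _; rewrite /= lee_fin.
rewrite normrM [leRHS]ger0_norm ?addr_ge0 ?sqr_ge0//.
rewrite -[B t w ^+ 2]real_normK ?num_real// -[B s w ^+ 2]real_normK ?num_real//.
have := sqr_ge0 (`|B t w| - `|B s w|); rewrite sqrrB.
have : 0 <= `|B t w| * `|B s w| by rewrite mulr_ge0.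
lra.
Qed.

(** Deduced from the second moment through [|u| <= 1 + u ^+ 2]. *)
Lemma fbm_integrable t : 0 <= t -> P.-integrable setT (EFin \o B t).
Proof.
move=> t0.
have i1 : P.-integrable setT (EFin \o cst (1 : R)).
  exact: finite_measure_integrable_cst.
have := integrableD measurableT i1 (fbm_integrable_sqr t0).
apply: le_integrable => //; first exact/measurable_EFinP.
move=> w _; rewrite /= lee_fin [leRHS]ger0_norm ?addr_ge0 ?sqr_ge0//.
rewrite -[B t w ^+ 2]real_normK ?num_real//.
by have := sqr_ge0 (`|B t w| - 2^-1); rewrite sqrrB; lra.
Qed.

Section linear_combination.
Variables (m : nat) (a t : 'I_m -> R).
Hypothesis t_ge0 : forall j, 0 <= t j.

Let Y w := \sum_(j < m) a j * B (t j) w.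

Lemma measurable_fbm_sum : measurable_fun setT Y.
Proof.
by apply: measurable_sum => j; apply: measurable_funM.
Qed.

Lemma fbm_sum_integrable : P.-integrable setT (EFin \o Y).
Proof.
rewrite (_ : EFin \o Y = fun w => (\sum_(j < m) (a j)%:E * (B (t j) w)%:E)%E); last first.
  by apply/funext => w; rewrite /= /Y -sumEFin; apply: eq_bigr => j _; rewrite EFinM.
by apply: integrable_sum => // j _; apply: integrableZl => //; exact: fbm_integrable.
Qed.

Lemma fbm_sum_mean : (\int[P]_w (Y w)%:E = 0)%E.
Proof.
have [_ mean _ _] := hB.
rewrite (eq_integral (fun w => (\sum_(j < m) (a j)%:E * (B (t j) w)%:E)%E)); last first.
  by move=> w _; rewrite /Y -sumEFin; apply: eq_bigr => j _; rewrite EFinM.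
rewrite integral_sum//; last first.
  by move=> j; apply: integrableZl => //; exact: fbm_integrable.
rewrite big1// => j _; rewrite integralZl//; last exact: fbm_integrable.
by have := mean (t j) (t_ge0 j); rewrite unlock => ->; rewrite mule0.
Qed.

Lemma fbm_sum_second_moment : (\int[P]_w (Y w ^+ 2)%:E =
  (\sum_(j < m) \sum_(k < m) a j * a k * fbm_cov H (t j) (t k))%:E)%E.
Proof.
have [_ _ cov _] := hB.
pose g (jk : 'I_m * 'I_m) w := ((a jk.1 * a jk.2)%:E * (B (t jk.1) w * B (t jk.2) w)%:E)%E.
rewrite (eq_integral (fun w => (\sum_(jk : 'I_m * 'I_m) g jk w)%E)); last first.
  move=> w _; rewrite /g -(pair_bigA _ (fun j k =>
    (a j * a k)%:E * (B (t j) w * B (t k) w)%:E)%E)/= /Y expr2 mulr_suml -sumEFin.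
  apply: eq_bigr => j _; rewrite mulr_sumr -sumEFin; apply: eq_bigr => k _.
  by rewrite -EFinM; congr EFin; ring.
rewrite integral_sum//; last first.
  by move=> jk; apply: integrableZl => //; exact: fbm_integrableM.
rewrite -sumEFin; under [RHS]eq_bigr do rewrite -sumEFin.
rewrite pair_bigA /=; apply: eq_bigr => jk _.
rewrite /g integralZl//; last exact: fbm_integrableM.
have := cov (t jk.1) (t jk.2) (t_ge0 _) (t_ge0 _).
by rewrite unlock => ->.
Qed.

End linear_combination.

Variables (T : R).
Hypothesis T0 : 0 < T.

Let K n i j := fbm_cov H (grid T n i) (grid T n j).

Let increment_cov n i j := K n i.+1 j.+1 - K n i.+1 j - K n i j.+1 + K n i j.

(** The mixed second difference removes the terms in one variable. What remains is half the second
    difference of [|u| ^ (2 * H)] at [u = grid T n i - grid T n j], nonnegative by convexity. *)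
Lemma fbm_increment_cov_ge0 n i j : 0 <= increment_cov n i j.
Proof.
have r1 : 1 <= 2 * H by move: hH; lra.
have := norm_powR_midpoint (grid T n i - grid T n j) (T / n%:R) r1.
have e1 : grid T n i - grid T n j + T / n%:R = grid T n i.+1 - grid T n j.
  by rewrite -(grid_step T n i); ring.
have e2 : grid T n i - grid T n j - T / n%:R = grid T n i - grid T n j.+1.
  by rewrite -(grid_step T n j); ring.
have e3 : grid T n i.+1 - grid T n j.+1 = grid T n i - grid T n j.
  have := grid_step T n i; have := grid_step T n j; lra.
by rewrite e1 e2 /increment_cov /K /fbm_cov e3; lra.
Qed.

(** Telescoping in both indices leaves the variance of [B T - B 0]. *)
Lemma sum_fbm_increment_cov n : (0 < n)%N ->
  \sum_(i < n) \sum_(j < n) increment_cov n i j = T `^ (2 * H).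
Proof.
move=> n0.
have H2 : 2 * H != 0 by rewrite gt_eqF//; move: hH; lra.
have row i : \sum_(j < n) increment_cov n i j =
    (K n i.+1 n - K n i.+1 0) - (K n i n - K n i 0).
  have tel k : K n k n - K n k 0 = \sum_(j < n) (K n k j.+1 - K n k j).
    by rewrite -(big_mkord xpredT (fun j => K n k j.+1 - K n k j)) telescope_sumr.
  by rewrite !tel -sumrB; apply: eq_bigr => j _; rewrite /increment_cov; ring.
under eq_bigr do rewrite row.
rewrite -(big_mkord xpredT (fun i => K n i.+1 n - K n i.+1 0 - (K n i n - K n i 0))).
rewrite (telescope_sumr (fun i => K n i n - K n i 0))//.
rewrite /K /fbm_cov gridn// !grid0 !subrr subr0 sub0r normrN normr0 powR0//.
by rewrite (gtr0_norm T0); lra.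
Qed.

(** As all covariances of increments are nonnegative, replacing each product [ci i * ci j] by
    [M ^+ 2] can only increase the variance. *)
Lemma fbm_RS_sum_expR_moment (c : R -> R) (M p : R) (n : nat) : (0 < n)%N ->
  (forall t, 0 <= t -> `|c t| <= M) ->
  (\int[P]_w (expR (p * \sum_(i < n)
     c (grid T n i) * (B (grid T n i.+1) w - B (grid T n i) w)))%:E <=
   (expR (p ^+ 2 * (M ^+ 2 * T `^ (2 * H)) / 2))%:E)%E.
Proof.
move=> n0 cM.
pose ci i := c (grid T n i).
(* [gaussian_process] speaks of combinations of values, so each increment becomes two terms: right
   end points in the first [n] indices, left end points with the opposite sign in the others. *)
pose a (j : 'I_(n + n)) := match fintype.split j with inl i => ci i | inr i => - ci i end.
pose t (j : 'I_(n + n)) :=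
  match fintype.split j with inl i => grid T n i.+1 | inr i => grid T n i end.
have t_ge0 j : 0 <= t j by rewrite /t; case: fintype.split => i; exact: grid_ge0.
have al (i : 'I_n) : a (lshift n i) = ci i by rewrite /a (unsplitK (inl i : 'I_n + 'I_n)).
have ar (i : 'I_n) : a (rshift n i) = - ci i by rewrite /a (unsplitK (inr i : 'I_n + 'I_n)).
have tl (i : 'I_n) : t (lshift n i) = grid T n i.+1.
  by rewrite /t (unsplitK (inl i : 'I_n + 'I_n)).
have tr (i : 'I_n) : t (rshift n i) = grid T n i.
  by rewrite /t (unsplitK (inr i : 'I_n + 'I_n)).
have SE w : \sum_(i < n) ci i * (B (grid T n i.+1) w - B (grid T n i) w) =
    \sum_(j < n + n) a j * B (t j) w.
  rewrite big_split_ord /= -big_split /=.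
  by apply: eq_bigr => i _; rewrite al ar tl tr; ring.
have [gauss _ _ _] := hB.
under eq_integral do rewrite SE.
apply: (gaussian_expR_moment (measurable_fbm_sum a t) p (gauss _ t a t_ge0)
  (fbm_sum_integrable a t_ge0) (fbm_sum_mean a t_ge0)).
rewrite fbm_sum_second_moment// lee_fin.
rewrite big_split_ord /= -(sum_fbm_increment_cov n0) mulr_sumr -big_split /=.
apply: ler_sum => i _; rewrite !big_split_ord /= -!big_split /= mulr_sumr.
apply: ler_sum => j _; rewrite !al !ar !tl !tr.
have -> : ci i * ci j * fbm_cov H (grid T n i.+1) (grid T n j.+1) +
    ci i * - ci j * fbm_cov H (grid T n i.+1) (grid T n j) +
    (- ci i * ci j * fbm_cov H (grid T n i) (grid T n j.+1) +
     - ci i * - ci j * fbm_cov H (grid T n i) (grid T n j)) =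
    ci i * ci j * increment_cov n i j by rewrite /increment_cov /K; ring.
rewrite ler_wpM2r ?fbm_increment_cov_ge0//.
by rewrite (le_trans (ler_norm _))// normrM expr2 ler_pM// cM// grid_ge0.
Qed.

End fractional_brownian_sums.

(** * Moments of the solution *)

Lemma integral_le_fatou {d : measure_display} {T : measurableType d} {R : realType}
  (mu : {measure set T -> \bar R}) (f : (T -> \bar R)^nat) (g : T -> \bar R) (M : \bar R) :
  (forall n, measurable_fun setT (f n)) -> (forall n w, 0 <= f n w)%E ->
  measurable_fun setT g -> (forall w, 0 <= g w)%E ->
  {ae mu, forall w, (g w <= limn_einf (f ^~ w))%E} ->
  (forall n, \int[mu]_w f n w <= M)%E -> (\int[mu]_w g w <= M)%E.
Proof.
move=> mf f0 mg g0 gf fM.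
have einf_le (u : (\bar R)^nat) v : (forall n, u n <= v)%E -> (limn_einf u <= v)%E.
  move=> uv; rewrite limn_einf_lim; apply: lime_le; first exact: is_cvg_einfs.
  apply: nearW => n; apply: le_trans (uv n).
  by apply: ereal_inf_lbound; exists n => /=.
apply: (@le_trans _ _ (limn_einf (fun n => \int[mu]_w f n w)%E)); last exact: einf_le.
apply: le_trans (fatou mu measurableT mf _); last by move=> n w _; exact: f0.
apply: ae_ge0_le_integral => //.
- move=> w _; rewrite limn_einf_lim; apply: lime_ge; first exact: is_cvg_einfs.
  apply: nearW => n; apply: le_ereal_inf_tmp => _ [m _ <-]; exact: f0.
- apply: measurableT_comp => //; apply: measurable_fun_limn_esup => n.
  exact: measurableT_comp.
- by move: gf; apply: filterS => w ? _.
Qed.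

Lemma is_RS_integral_grid {R : realType} (g h : R -> R) (T l : R) : 0 < T ->
  is_RS_integral g h 0 T l ->
  \sum_(i < n) g (grid T n i) * (h (grid T n i.+1) - h (grid T n i)) @[n --> \oo] --> l.
Proof.
move=> T0 /is_RS_integralP H; apply/cvgrPdist_lt => e /H[delta d0 Hd].
near=> n; rewrite distrC; apply: Hd.
have n0 : (0 < n)%N by near: n; exact: nbhs_infty_gt.
rewrite -[X in RS_value _ _ X](grid0 T n) -[X in RS_value _ _ _ X](gridn T n0).
apply: (@RS_value_sum _ _ _ (grid T n)
  (fun i => g (grid T n i) * (h (grid T n i.+1) - h (grid T n i)))) => i ni.
apply: RS_value1; first exact: grid_lt.
  by rewrite lexx grid_le.
by rewrite grid_step; near: n; exact: grid_step_lt.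
Unshelve. all: by end_near. Qed.

(** The integral of [c] is handed over as a limit of grid sums. These are random variables, so
    measurability can be discussed on them rather than on [y]. *)
Lemma pathwise_solution_bound {R : realType} {d : measure_display}
  {Omega : measurableType d} (P : probability Omega R) (B X : R -> {RV P >-> R})
  (kappa lambda : R) (f : R -> R -> R) (c : R -> R) (X0 T : R) :
  1 < kappa -> 0 < lambda -> 0 < T ->
  {ae P, forall w, {within `[0, +oo[, continuous (fun t => B t w)}} ->
  (forall t x : R, 0 < t ->
    x * f t x <= - lambda * kappa * t `^ (kappa - 1) * x ^+ 2) ->
  pathwise_integrable c B -> pathwise_solution f c B X0 X ->
  {ae P, forall w, exists2 y,
    \sum_(i < n) c (grid T n i) * (B (grid T n i.+1) w - B (grid T n i) w)
      @[n --> \oo] --> y &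
    `|X T w| <= `|X0| * expR (- lambda * T `^ kappa + y)}.
Proof.
move=> k1 l0 T0 cB hf hcB hX.
move: cB hcB hX; apply: filterS3 => w cB hcB hX.
(* Choice asks for a value at every real [t]; at negative times it is the dummy 0. *)
have /choice[y hy] : forall t, exists l : R,
    0 <= t -> is_RS_integral c (fun s => B s w) 0 t l.
  move=> t; have [t0|t0] := pselect (0 <= t); last by exists 0.
  by have [l Hl] := hcB t t0; exists l.
have /choice[I hI] : forall t, exists l : R, 0 <= t ->
    is_RS_integral (fun s => c s * X s w) (fun s => B s w) 0 t l /\
    X t w = X0 + \int[lebesgue_measure]_(s in `[0, t]) f s (X s w) + l.
  move=> t; have [t0|t0] := pselect (0 <= t); last by exists 0.
  by have [_ [l Hl Xl]] := hX t t0; exists l.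
exists (y T).
  exact: (@is_RS_integral_grid _ c (fun s => B s w) T (y T) T0 (hy T (ltW T0))).
have [f_int _] := hX T (ltW T0).
apply: (@pathwise_bound _ T lambda kappa X0 (fun s => B s w) c (fun s => X s w) y
  (fun s => f s (X s w)) I) => //.
- apply: continuous_subspaceW cB => t; rewrite /= !in_itv/= => /andP[-> _].
  by [].
- by move=> t t0 _; exact: hy.
- by move=> t t0 _; have [] := hI t t0.
- by move=> t t0 _; have [] := hI t t0.
- by move=> r r0 _; exact: hf.
Qed.

Lemma solution_moment_bound {R : realType} {d : measure_display}
  {Omega : measurableType d} (P : probability Omega R) (H : R) (B X : R -> {RV P >-> R})
  (p kappa lambda mu : R) (f : R -> R -> R) (c : R -> R) (X0 T : R) :
  2^-1 < H -> fractional_brownian_motion H B -> 0 < p ->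
  1 < kappa -> 0 < lambda -> 0 < T ->
  (forall t x : R, 0 < t ->
    x * f t x <= - lambda * kappa * t `^ (kappa - 1) * x ^+ 2) ->
  (forall t : R, 0 <= t -> `|c t| <= mu) ->
  pathwise_integrable c B -> pathwise_solution f c B X0 X ->
  ('E_P[(fun w => `|X T w| `^ p)%R] <=
    (`|X0| `^ p * expR (- (p * lambda) * T `^ kappa +
      p ^+ 2 * (mu ^+ 2 * T `^ (2 * H)) / 2))%:E)%E.
Proof.
move=> hH hB p0 k1 l0 T0 hf hc hcB hX; rewrite unlock.
have mB t : measurable_fun setT (B t : Omega -> R) by exact: measurable_funP.
have mX : measurable_fun setT (X T : Omega -> R) by exact: measurable_funP.
pose S n w := \sum_(i < n) c (grid T n i) * (B (grid T n i.+1) w - B (grid T n i) w).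
have mS n : measurable_fun setT (S n).
  apply: measurable_sum => i; apply: measurable_funM => //.
  exact: measurable_funB.
pose C := `|X0| `^ p * expR (- (p * lambda) * T `^ kappa).
have C0 : 0 <= C by rewrite mulr_ge0 ?powR_ge0 ?expR_ge0.
have mE n : measurable_fun setT (fun w => expR (p * S n.+1 w)).
  by apply: measurableT_comp => //; exact: measurable_funM.
(* The shift to [n.+1] avoids the empty grid, for which the moment bound is not stated. *)
apply: (@integral_le_fatou _ _ _ P (fun n w => (C * expR (p * S n.+1 w))%:E)).
- by move=> n; apply/measurable_EFinP; exact: measurable_funM.
- by move=> n w; rewrite lee_fin mulr_ge0// expR_ge0.
- apply/measurable_EFinP; apply: (@measurableT_comp _ _ _ _ _ _ (@powR R ^~ p)) => //.
  exact: measurableT_comp.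
- by move=> w; rewrite lee_fin powR_ge0.
- have [_ _ _ cB] := hB.
  have := pathwise_solution_bound k1 l0 T0 cB hf hcB hX.
  apply: filterS => w [y Sy Xy].
  have Ey : (C * expR (p * S n.+1 w))%:E @[n --> \oo] --> (C * expR (p * y))%:E.
    apply/cvg_EFin; first exact: nearW.
    apply: cvgM; first exact: cvg_cst.
    apply: (cvg_comp (fun n => p * S n.+1 w) expR); last exact: continuous_expR.
    apply: cvgM; first exact: cvg_cst.
    by rewrite (cvg_shiftS (S ^~ w)).
  have [-> _] := cvg_limn_einf_sup Ey.
  rewrite lee_fin; apply: (@le_trans _ _ ((`|X0| * expR (- lambda * T `^ kappa + y)) `^ p)).
    by apply: ge0_ler_powR => //; rewrite ?nnegrE ?(ltW p0)// mulr_ge0// expR_ge0.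
  rewrite powRM ?expR_ge0// -expRM /C -mulrA -expRD.
  rewrite ler_wpM2l ?powR_ge0// ler_expR.
  by rewrite [leLHS](_ : _ = - (p * lambda) * T `^ kappa + p * y)//; ring.
- move=> n; under eq_integral do rewrite EFinM.
  rewrite ge0_integralZl_EFin//; last exact/measurable_EFinP.
  rewrite [leRHS](_ : _ = C%:E * (expR (p ^+ 2 * (mu ^+ 2 * T `^ (2 * H)) / 2))%:E)%E.
    by rewrite lee_wpmul2l ?lee_fin//; exact: (fbm_RS_sum_expR_moment hH hB T0).
  by rewrite -EFinM /C expRD; congr EFin; exact: mulrA.
Qed.

(** A linear rate is enough for the limit, and [t <= t ^ (2 * H)] for [t >= 1] provides it once the
    exponent is at most a negative multiple of [t ^ (2 * H)]. *)
Lemma decay_exponent {R : realType} (H p kappa lambda mu : R) :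
  2^-1 < H -> 0 < p -> 0 < lambda ->
  (2 * H < kappa) \/ (kappa = 2 * H /\ - lambda + p / 2 * mu ^+ 2 < 0) ->
  exists2 eta, 0 < eta & \forall t \near +oo,
    - (p * lambda) * t `^ kappa + p ^+ 2 * (mu ^+ 2 * t `^ (2 * H)) / 2 <= - (t * eta).
Proof.
move=> hH p0 l0 hcase.
have H1 : 1 <= 2 * H by move: hH; lra.
case: hcase => [Hk|[-> lmu]]; last first.
  have eta0 : 0 < p * (lambda - p / 2 * mu ^+ 2) by rewrite mulr_gt0//; move: lmu; lra.
  exists (p * (lambda - p / 2 * mu ^+ 2)) => //; near=> t.
  have t1 : 1 <= t by near: t; exact: nbhs_pinfty_ge.
  have tH : t <= t `^ (2 * H) by exact: le1r_powR.
  have := ler_wpM2r (ltW eta0) tH; lra.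
exists p => //.
(* Once [t ^ (kappa - 2 * H)] exceeds [L], the factor [lambda * t ^ (kappa - 2 * H) - p * mu ^+ 2 /
   2] is at least 1, which leaves the rate [p]. *)
pose L := (1 + p * mu ^+ 2 / 2) / lambda.
have L0 : 0 < L by rewrite divr_gt0// ltr_pwDl// divr_ge0// mulr_ge0 ?sqr_ge0// ltW.
have k0 : 0 < kappa - 2 * H by rewrite subr_gt0.
near=> t.
have t1 : 1 <= t by near: t; exact: nbhs_pinfty_ge.
have t0 : 0 < t by exact: lt_le_trans t1.
have tL : L `^ (kappa - 2 * H)^-1 <= t by near: t; exact: nbhs_pinfty_ge.
have tH : t <= t `^ (2 * H) by exact: le1r_powR.
have Lt : L <= t `^ (kappa - 2 * H).
  have -> : L = (L `^ (kappa - 2 * H)^-1) `^ (kappa - 2 * H).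
    by rewrite -powRrM mulVf ?powRr1 ?(ltW L0)// gt_eqF.
  by apply: ge0_ler_powR; rewrite ?nnegrE ?powR_ge0 ?(ltW k0) ?(ltW t0).
have -> : t `^ kappa = t `^ (2 * H) * t `^ (kappa - 2 * H).
  by rewrite -powRD ?subrKC// (gt_eqF t0) implybT.
have tk : 1 + p * mu ^+ 2 / 2 <= lambda * t `^ (kappa - 2 * H).
  by rewrite -ler_pdivrMl // mulrC; exact: Lt.
have h1 := ler_wpM2l (powR_ge0 t (2 * H)) tk.
have h2 : p * t <=
    p * (t `^ (2 * H) * (lambda * t `^ (kappa - 2 * H) - p * mu ^+ 2 / 2)).
  by rewrite ler_wpM2l ?(ltW p0)// (le_trans tH)//; move: h1; lra.
move: h2; lra.
Unshelve. all: by end_near. Qed.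

Unset Implicit Arguments.

Theorem theorem3p1 (R : realType) (d : measure_display)
  (Omega : measurableType d) (P : probability Omega R)
  (H : R) (hH : 2^-1 < H < 1)
  (B : R -> {RV P >-> R}) (hB : fractional_brownian_motion H B)
  (p kappa lambda mu : R)
  (hp : 1 <= p) (hkappa : 2 * H <= kappa) (hlambda : 0 < lambda) (hmu : 0 < mu)
  (hcase : (2 * H < kappa /\ 0 < lambda) \/
           (kappa = 2 * H /\ - lambda + p / 2 * mu ^+ 2 < 0))
  (f : R -> R -> R)
  (hf : forall t x : R, 0 < t ->
          x * f t x <= - lambda * kappa * t `^ (kappa - 1) * x ^+ 2)
  (c : R -> R) (hc : forall t : R, 0 <= t -> `|c t| <= mu)
  (hcB : pathwise_integrable c B)
  (X0 : R) (hX0 : X0 != 0)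
  (X : R -> {RV P >-> R}) (hX : pathwise_solution f c B X0 X) :
  'E_P[(fun w => `|X t w| `^ p)%R]%E @[t --> +oo] --> 0%E.
Proof.
have /andP[H0 _] := hH.
have p0 : 0 < p by exact: lt_le_trans hp.
have k1 : 1 < kappa by move: H0 hkappa; lra.
have [|eta eta0 decay] := @decay_exponent R H p kappa lambda mu H0 p0 hlambda.
  by case: hcase => [[? _]|]; [left|right].
have lim0 : (`|X0| `^ p * expR (- (t * eta)))%:E @[t --> +oo] --> 0%E.
  apply/cvg_EFin; first exact: nearW.
  rewrite -[X in _ --> X](mulr0 (`|X0| `^ p)); apply: cvgM; first exact: cvg_cst.
  apply: (@cvg_comp _ _ _ (fun t => t * eta) (fun t => expR (- t)) _ (pinfty_nbhs R)).
    exact: gt0_cvgMly.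
  exact: cvgr_expR.
apply: (squeeze_cvge _ (cvg_cst _) lim0); near=> t.
have t0 : 0 < t by near: t; exact: nbhs_pinfty_gt.
rewrite expectation_ge0 => [|w]; last exact: powR_ge0.
apply: le_trans (solution_moment_bound H0 hB p0 k1 hlambda t0 hf hc hcB hX) _.
rewrite lee_fin ler_wpM2l ?powR_ge0// ler_expR; near: t; exact: decay.
Unshelve. all: by end_near. Qed.
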